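(* For each $\nu>-1$ the radius of convexity $r^c(w_\nu)$ satisfies $r^c(w_\nu)<8(\nu+1)^2(\nu+2)$. Moreover, if $\nu>-1$, then $$4(\nu+1)^2(\nu+2)<r^c(w_\nu)<\frac{64(\nu+1)(\nu+1)_4}{7\nu^2+94\nu+183}$$ and $$16(\nu+1)^2(\nu+2)\sqrt{\frac{(\nu+3)(\nu+4)}{\nu_{19}}}<r^c(w_\nu)<\frac{8(\nu+1)(\nu+1)_3(\nu+5)_2\,\nu_{19}}{\nu_{20}},$$ where $$\nu_{19}=7\nu^2+94\nu+183,\qquad \nu_{20}=9\nu^5+264\nu^4+3108\nu^3+16222\nu^2+37827\nu+32138.$$
   Context: For $\nu>-1$, with $J_\nu,I_\nu$ the Bessel and modified Bessel functions of the first kind, $$\mathbf{\Pi}_\nu(z)=J_\nu(z)I_\nu(z)=\sum_{n\ge0}\frac{(-1)^n(z/2)^{2\nu+4n}}{n!\,\Gamma(\nu+n+1)\Gamma(\nu+2n+1)},$$ $$w_\nu(z)=2^{2\nu}z^{-\frac{\nu}{2}+1}\Gamma^2(\nu+1)\mathbf{\Pi}_\nu(\sqrt[4]{z})=\sum_{n\ge0}\frac{(-1)^n z^{n+1}}{2^{4n}n!\,(\nu+1)_n(\nu+1)_{2n}}.$$ The radius of convexity is $r^c(f)=\sup\{r>0:\operatorname{Re}(1+zf''(z)/f'(z))>0\text{ for all }|z|<r\}$. Pochhammer symbol: $(a)_0=1$, $(a)_n=a(a+1)\cdots(a+n-1)$. *)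

(* Defs.v *)
(* [R : realType] is the real line and [R[i]] the field of complex numbers. *)
From HB Require Import structures.
From mathcomp Require Import all_boot all_order all_algebra.
From mathcomp.real_closed Require Import complex.
From mathcomp Require Import all_classical all_reals all_analysis.

Set Implicit Arguments.
Unset Strict Implicit.
Unset Printing Implicit Defensive.
Import Order.TTheory GRing.Theory Num.Theory.
Import numFieldNormedType.Exports.

Local Open Scope classical_set_scope.
Local Open Scope complex_scope.
Local Open Scope ring_scope.

(* The rising factorial (a)_n = a (a + 1) ... (a + n - 1). *)
Definition pochhammer (R : realType) (a : R) (n : nat) : R :=
  \prod_(i < n) (a + i%:R).

(* Euler's integral; only used for x > 0, where the integral converges. *)
Definition Gamma (R : realType) (x : R) : R :=
  (\int[lebesgue_measure]_(t in `]0%R, +oo[) (t `^ (x - 1) * expR (- t)))%R.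

(* The principal argument, in ]-pi, pi], of z != 0. *)
Definition Carg (R : realType) (z : R[i]) : R :=
  let t := acos (complex.Re z / Normc.normc z) in
  if 0 <= complex.Im z then t else - t.

(* The principal branch of z ^ a for a real exponent a. As for [powR],
   0 ^ 0 = 1 and 0 ^ a = 0 for a != 0. *)
Definition Cpowr (R : realType) (z : R[i]) (a : R) : R[i] :=
  (Normc.normc z `^ a)%:C * (cos (a * Carg z) +i* sin (a * Carg z)).

Definition Csum (R : realType) (u : nat -> R[i]) : R[i] :=
  limn (series (u : nat -> R[i]^o)).

Definition besselJ (R : realType) (nu : R) (z : R[i]) : R[i] :=
  Csum (fun n : nat =>
    ((-1) ^+ n / (n`!%:R * Gamma (nu + n%:R + 1)))%:C
      * Cpowr (z / 2) (nu + n.*2%:R)).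

Definition besselI (R : realType) (nu : R) (z : R[i]) : R[i] :=
  Csum (fun n : nat =>
    (1 / (n`!%:R * Gamma (nu + n%:R + 1)))%:C
      * Cpowr (z / 2) (nu + n.*2%:R)).

Definition bessel_prod (R : realType) (nu : R) (z : R[i]) : R[i] :=
  besselJ nu z * besselI nu z.

(* For z != 0 the branches cancel (the principal fourth root has its argument
   in ]-pi/4, pi/4]), so this is the entire function
     \sum_n (-1)^n z^(n+1) / (2^(4n) n! (nu+1)_n (nu+1)_(2n)).
   At z = 0 the conventions of [Cpowr] make one of the factors vanish for every
   nu (the factor z ^ (1 - nu/2), or J_2(0) when nu = 2), which gives the value
   0 of this series. *)
Definition bessel_w (R : realType) (nu : R) (z : R[i]) : R[i] :=
  (2 `^ (2 * nu))%:C * Cpowr z (- nu / 2 + 1)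
    * (Gamma (nu + 1) ^+ 2)%:C * bessel_prod nu (Cpowr z (1 / 4)).

Definition Cderive (R : realType) (f : R[i] -> R[i]) : R[i] -> R[i] :=
  @derive1 R[i] R[i]^o f.

(* The supremum is taken in the extended reals. The condition f'(z) != 0 makes
   the quotient meaningful, division by 0 being total here. *)
Definition radius_of_convexity (R : realType) (f : R[i] -> R[i]) : \bar R :=
  ereal_sup [set r%:E | r in [set r : R | 0 < r /\
    forall z : R[i], `|z| < r%:C ->
      Cderive f z != 0 /\
      0 < complex.Re (1 + z * Cderive (Cderive f) z / Cderive f z)]].

Definition nu19 (R : realType) (nu : R) : R :=
  7 * nu ^+ 2 + 94 * nu + 183.

Definition nu20 (R : realType) (nu : R) : R :=
  9 * nu ^+ 5 + 264 * nu ^+ 4 + 3108 * nu ^+ 3 + 16222%:R * nu ^+ 2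
    + 37827%:R * nu + 32138%:R.

(* Main.v *)
Require Import Defs.
From HB Require Import structures.
From mathcomp Require Import all_boot all_order all_algebra.
From mathcomp.real_closed Require Import complex.
From mathcomp Require Import all_classical all_reals all_analysis.
From mathcomp Require Import ring lra measurable_realfun.
From mathcomp.real_closed Require Import polyrcf.

Set Implicit Arguments.
Unset Strict Implicit.
Unset Printing Implicit Defensive.
Import Order.TTheory GRing.Theory Num.Theory.
Import numFieldNormedType.Exports.

Local Open Scope classical_set_scope.
Local Open Scope complex_scope.
Local Open Scope ring_scope.

(** Write t = nu + 1, so t > 0. The function w is the entire function
    z sum_n b_n z^n with b_n = (-1)^n / (16^n n! (t)_n (t)_2n); this rests on the
    functional equation of Gamma ([GammaD1]), on the cancellation of the branches
    of the powers ([Cpowr_cancel]) and on the coefficients of J I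
    ([cauchy_prod_ji_even], [cauchy_prod_ji_odd]). Put D = (z w')', so that
    1 + z w''/w' = D/w'.

    Lower bounds. Suppose that w' were a polynomial P with P(0) = 1 and only
    positive zeros g_i. Then z P'/P = - sum_i z/(g_i - z), whose modulus is at
    most - r P'(r)/P(r) for |z| = r below the zeros, and so the radius of
    convexity is at least the first zero of D = (z P)'. If D has the zeros d_i,
    all positive, and D(0) = 1, then d_1^(-3) <= sum_i d_i^(-3), which is a
    polynomial in the first three coefficients of D ([powersum3]). So the
    radius exceeds every L such that L^3 sum_i d_i^(-3) < 1; the cube of the
    zeros is used rather than the square since L is itself the bound given by
    the squares, and a strict inequality is wanted. The function w' is not a
    polynomial, but it is a limit of polynomials with positive zeros, and the
    bounds are uniform enough to pass to the limit ([radius_gt]). The approximants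
    are obtained from (1 - k X)^m, where k = 1/(16 m^4), by operators p + d X p'
    with d >= 0, which multiply the coefficient of X^n by 1 + d n and keep all
    zeros real and positive ([poszeros_op]). For d = 1/(t + j) and d = 2/(t + j)
    with j < m the products of these factors are (t + m)_n / (t)_n and
    (t + m)_2n / (t)_2n ([prod1D_pochhammer]), which after division by m^n and
    m^2n tend to 1/(t)_n and 1/(t)_2n; the last operator, with d = 1, gives the
    factor n + 1 of the coefficients of w'.

    Upper bounds. If D is nonpositive at some x > 0 where w' is positive, then
    the radius is at most x. On the positive axis the series of D and w' are
    alternating with decreasing terms, from n = 1 on for D, so that five terms
    of D bound it from above and two terms of w' bound it from below
    ([radius_le]). The five terms of D are negative at the last upper bound of
    the theorem ([dtrunc_yU]), hence a little before it as well.

    What remains are inequalities between polynomials in t, each with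
    nonnegative coefficients after moving everything to one side. *)

(** * Polynomial inequalities for the bounds *)

Section Numeric.
Variable R : realFieldType.
Implicit Types t A B : R.

(** These are [nu19] and [nu20] at nu = t - 1. *)
Definition polyA t : R := 96 + 80 * t + 7 * t ^+ 2.
Definition polyB t : R :=
  7680 + 13696%:R * t + 8392 * t ^+ 2 + 2142 * t ^+ 3 + 219 * t ^+ 4 + 9 * t ^+ 5.

Lemma polyA_gt0 t : 0 < t -> 0 < polyA t.
Proof. by move=> t0; rewrite /polyA; have := exprn_gt0 2 t0; lra. Qed.

Lemma polyB_gt0 t : 0 < t -> 0 < polyB t.
Proof.
move=> t0; rewrite /polyB; have p k := exprn_gt0 k t0.
by move: (p 2%N) (p 3%N) (p 4%N) (p 5%N); clear p => *; lra.
Qed.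

(** The sharpest upper bound of the radius is below 8 t^2 (t + 1). *)
Lemma bound_first t : 0 < t -> (t + 2) * (t + 4) * (t + 5) * polyA t < polyB t.
Proof.
move=> t0; rewrite /polyA /polyB; have p k := exprn_gt0 k t0.
by move: (p 2%N) (p 3%N) (p 4%N) (p 5%N); clear p => *; lra.
Qed.

(** The sharpest upper bound of the radius is below the one with denominator
    [nu19]. *)
Lemma bound_second t : 0 < t ->
  (t + 4) * (t + 5) * polyA t ^+ 2 < 8 * (t + 3) * polyB t.
Proof.
move=> t0; rewrite /polyA /polyB; have p k := exprn_gt0 k t0.
by move: (p 2%N) (p 3%N) (p 4%N) (p 5%N) (p 6%N); clear p => *; lra.
Qed.

(** The two lower bounds are in the ratio of 1/4 to the square root of
    (t + 2)(t + 3)/A. *)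
Lemma bound_lower t : 0 < t -> polyA t < 16 * ((t + 2) * (t + 3)).
Proof. by move=> t0; rewrite /polyA; have := exprn_gt0 2 t0; lra. Qed.

(** With S2 and S3 the sums of the squares and of the cubes of the inverse zeros
    of D, this is S3^2 < S2^3. *)
Lemma bound_cubic t : 0 < t ->
  4 * (t + 3) * polyB t ^+ 2 < (t + 2) * (t + 4) ^+ 2 * (t + 5) ^+ 2 * polyA t ^+ 3.
Proof.
move=> t0; rewrite /polyA /polyB; have p k := exprn_gt0 k t0.
move: (p 4%N) (p 5%N) (p 6%N) (p 7%N) (p 8%N) (p 9%N) (p 10%N) (p 11%N).
by clear p => *; lra.
Qed.

(** The negativity of [dtrunc] at [yU], cleared of denominators. All terms of
    degree below 4 in t cancel. *)
Lemma bound_quartic t A B : 0 < t -> A = polyA t -> B = polyB t ->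
  384 * (t + 3) ^+ 2 * (t + 6) * (t + 7) * B ^+ 4
  + 432 * t ^+ 2 * (t + 2) * (t + 3) * (t + 6) * (t + 7) * (t + 4) ^+ 2 * (t + 5) ^+ 2
    * A ^+ 2 * B ^+ 2
  + 25 * t ^+ 6 * (t + 1) ^+ 2 * (t + 2) ^+ 2 * (t + 4) ^+ 3 * (t + 5) ^+ 3 * A ^+ 4 <
  768 * (t + 2) * (t + 3) ^+ 2 * (t + 4) * (t + 5) * (t + 6) * (t + 7) * A * B ^+ 3
  + 128 * t ^+ 4 * (t + 1) * (t + 2) * (t + 3) * (t + 4) ^+ 2 * (t + 5) ^+ 2
    * (t + 6) * (t + 7) * A ^+ 3 * B.
Proof.
move=> t0 -> ->; rewrite /polyA /polyB; have p k := exprn_gt0 k t0.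
move: (p 4%N) (p 5%N) (p 6%N) (p 7%N) (p 8%N) (p 9%N) (p 10%N) (p 11%N) (p 12%N)
  (p 13%N) (p 14%N) (p 15%N) (p 16%N) (p 17%N) (p 18%N) (p 19%N) (p 20%N) (p 21%N)
  (p 22%N) (p 23%N) (p 24%N).
by clear p => *; lra.
Qed.
End Numeric.

(** * Euler's integral *)

Section Gamma.
Variable R : realType.
Local Notation mu := (@lebesgue_measure R).
Implicit Types x t : R.

(** The integrand may be unbounded at 0, so the half-lines starting at 1/(n + 1)
    are used and n goes to infinity. *)
Lemma ge0_FTC2_oy (f F : R -> R) (l L : R) :
  (forall t, 0 < t -> 0 <= f t) -> (forall t, 0 < t -> {for t, continuous f}) ->
  (forall t, 0 < t -> is_derive t 1 F (f t)) ->
  F t @[t --> 0^'+] --> l -> F t @[t --> +oo] --> L ->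
  (\int[mu]_(t in `]0%R, +oo[) (f t)%:E = (L - l)%:E)%E.
Proof.
move=> f0 cf dF Fl FL.
pose E (n : nat) : set R := `[n.+1%:R^-1, +oo[%classic.
have E0 n t : E n t -> 0 < t.
  by rewrite /E /= in_itv /= andbT; apply: lt_le_trans; rewrite invr_gt0.
have Eoy : `]0%R, +oo[%classic = \bigcup_n E n.
  apply/seteqP; split => t /=; last by move=> [n _ /E0]; rewrite in_itv /= andbT.
  rewrite in_itv /= andbT => t0; exists (Num.truncn t^-1) => //.
  rewrite /E /= in_itv /= andbT invf_ple ?posrE//.
  by apply/ltW; rewrite truncnS_gt.
have mf : measurable_fun (`]0, +oo[ : set R) f.
  apply: open_continuous_measurable_fun => //= t.
  by rewrite inE /= in_itv /= andbT => /cf.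
have EI n : (\int[mu]_(t in E n) (f t)%:E = (L - F n.+1%:R^-1)%:E)%E.
  have n0 : 0 < n.+1%:R^-1 :> R by rewrite invr_gt0.
  rewrite /E (@ge0_continuous_FTC2y _ f F _ L) //.
  - by move=> t nt; apply: f0; exact: lt_le_trans nt.
  - apply/continuous_within_itvcyP; split.
      by move=> t; rewrite in_itv /= andbT => nt; apply: cf; exact: lt_trans nt.
    by apply: cvg_at_right_filter; exact: cf.
  - by move=> t nt; have [] := dF t (lt_trans n0 nt).
  - apply: cvg_at_right_filter; apply: differentiable_continuous.
    by apply/derivable1_diffP; have [] := dF _ n0.
  - move=> t; rewrite in_itv /= andbT => nt; rewrite derive1E.
    by have := dF t (lt_trans n0 nt) => /@derive_val.
have Ec : (\int[mu]_(t in E n) (f t)%:E @[n --> \oo] -->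
    \int[mu]_(t in `]0%R, +oo[) (f t)%:E)%E.
  rewrite Eoy; apply: ge0_nondecreasing_set_cvg_integral.
  - move=> m n mn; apply/subsetPset; apply: subset_itvr; rewrite bnd_simp.
    by rewrite lef_pV2 ?posrE// ler_nat.
  - by move=> i; exact: measurable_itv.
  - move=> i; apply/measurable_EFinP; apply: measurable_funS mf => //.
    by move=> t /E0; rewrite /= in_itv /= andbT.
  - by move=> n t /E0 /f0; rewrite lee_fin.
have Ec' : (\int[mu]_(t in E n) (f t)%:E @[n --> \oo] --> (L - l)%:E)%E.
  under eq_cvg do rewrite EI.
  apply: cvg_EFin; first exact: nearW.
  apply: cvgB; first exact: cvg_cst.
  move/cvg_at_rightP : Fl; apply; split => [n|]; first by rewrite invr_gt0.
  exact: cvg_harmonic.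
exact: (cvg_unique _ Ec Ec').
Qed.

Let gker x t := t `^ (x - 1) * expR (- t).

Let continuous_gker x t : 0 < t -> {for t, continuous (gker x)}.
Proof.
move=> t0; apply: continuousM.
  apply: differentiable_continuous; apply/derivable1_diffP.
  by have [] := is_derive1_powR (x - 1) t0.
by apply: continuous_comp; [exact: opp_continuous|exact: continuous_expR].
Qed.

Let measurable_gker x : measurable_fun (`]0, +oo[ : set R) (gker x).
Proof.
apply: open_continuous_measurable_fun => //= t.
by rewrite inE /= in_itv /= andbT => t0; exact: continuous_gker.
Qed.

Let gker_ge0 x t : 0 <= gker x t.
Proof. by rewrite mulr_ge0 ?powR_ge0 ?expR_ge0. Qed.

(** From e^u >= u at u = t/(2x). *)
Let powR_le_expR x t : 0 < x -> 0 < t -> t `^ x <= (2 * x) `^ x * expR (t / 2).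
Proof.
move=> x0 t0.
have -> : t `^ x = (2 * x) `^ x * (t / (2 * x)) `^ x.
  by rewrite -powRM ?mulr_ge0 ?invr_ge0 ?ltW ?mulr_gt0// mulrC divfK// gt_eqF ?mulr_gt0.
rewrite ler_wpM2l ?powR_ge0//.
have -> : expR (t / 2) = (expR (t / (2 * x))) `^ x.
  by rewrite -expRM invfM mulrA; congr expR; field; rewrite gt_eqF.
rewrite ge0_ler_powR ?nnegrE ?expR_ge0 ?(ltW x0) ?divr_ge0 ?mulr_ge0 ?ltW//.
by apply: lt_le_trans (expR_ge1Dx _); rewrite ltrDr.
Qed.


Let h t := expR (- (t / 2)).

Let derive_h t : is_derive t 1 h (- (h t / 2)).
Proof.
have d : is_derive t 1 (fun u : R => - (u / 2)) (- 2^-1).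
  by apply: is_derive_eq; rewrite /GRing.scale /= ; field.
have := @is_derive1_comp R expR (fun u => - (u / 2)) t _ _ (is_derive_expR _) d.
by move=> H; apply: is_derive_eq; rewrite /h /=; field.
Qed.

Let continuous_h : continuous h.
Proof.
move=> t; apply: differentiable_continuous; apply/derivable1_diffP.
by have [] := derive_h t.
Qed.

Let h_cvgy : h t @[t --> +oo] --> 0.
Proof.
have -> : h = (fun x => expR (- x)) \o (fun t => 2^-1 * t).
  by apply/funext => t; rewrite /h /= mulrC.
apply: (@cvg_comp _ _ _ (fun t : R => 2^-1 * t) (fun x => expR (- x)) _ (pinfty_nbhs R)).
  by apply: gt0_cvgMry.
exact: cvgr_expR.
Qed.

Let integral_h (M : R) : 0 <= M ->
  (\int[mu]_(t in `]0%R, +oo[) (M * h t)%:E = (2 * M)%:E)%E.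
Proof.
move=> M0; rewrite -[2 * M]opprK -sub0r.
apply: (@ge0_FTC2_oy _ (fun t => - (2 * M) * h t)).
- by move=> t _; rewrite mulr_ge0 ?expR_ge0.
- by move=> t _; apply: continuousM; [exact: cst_continuous|exact: continuous_h].
- move=> t _; have H := derive_h t; apply: is_derive_eq.
  by rewrite /GRing.scale /=; field.
- rewrite -[X in _ --> X]mulr1; apply: cvgM; first exact: cvg_cst.
  apply: cvg_at_right_filter.
  by have := @continuous_h 0; rewrite /continuous_at {2}/h mul0r oppr0 expR0.
- by rewrite -[X in _ --> X](mulr0 (- (2 * M))); apply: cvgM h_cvgy; exact: cvg_cst.
Qed.

(** Integration by parts, that is, integration of the derivative of t^x e^(-t).
    This derivative changes sign; adding to it a large multiple of e^(-t/2),
    whose integral is known, makes it nonnegative, and then the integrals can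
    be split before they are known to be finite. *)
Lemma Gamma_integral x : 0 < x ->
  (\int[mu]_(t in `]0%R, +oo[) (gker x t)%:E \is a fin_num)%E
  /\ (\int[mu]_(t in `]0%R, +oo[) (gker (x + 1) t)%:E =
       x%:E * \int[mu]_(t in `]0%R, +oo[) (gker x t)%:E)%E.
Proof.
move=> x0; pose M := (2 * x) `^ x.
have M0 : 0 <= M by exact: powR_ge0.
have le_M t : 0 < t -> gker (x + 1) t <= M * h t.
  move=> t0; rewrite /gker addrK.
  have -> : h t = expR (t / 2) * expR (- t) by rewrite /h -expRD; congr expR; field.
  by rewrite mulrA ler_wpM2r ?expR_ge0// powR_le_expR.
have mx y : measurable_fun (`]0, +oo[ : set R) (EFin \o gker y).
  exact/measurable_EFinP.
have mMh : measurable_fun (`]0, +oo[ : set R) (fun t => M * h t).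
  apply: measurable_funM => //; apply: (@measurable_funS _ _ _ _ setT) => //.
  exact: continuous_measurable_fun.

have mMhE : measurable_fun (`]0, +oo[ : set R) (EFin \o (fun t => M * h t)).
  exact/measurable_EFinP.
have Gx1 : (\int[mu]_(t in `]0%R, +oo[) (gker (x + 1) t)%:E <= (2 * M)%:E)%E.
  rewrite -integral_h//; apply: ge0_le_integral => //.
  - by move=> t _; rewrite lee_fin.
  - exact: mx.
  - by move=> t; rewrite /= in_itv /= andbT => /le_M; rewrite lee_fin.
have Gx1f : (\int[mu]_(t in `]0%R, +oo[) (gker (x + 1) t)%:E \is a fin_num)%E.
  rewrite ge0_fin_numE; last by apply: integral_ge0 => t _; rewrite lee_fin.
  by apply: le_lt_trans Gx1 _; rewrite ltry.
have dker t : 0 < t -> is_derive t 1 (gker (x + 1)) (x * gker x t - gker (x + 1) t).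
  move=> t0; have d := is_derive1_powR x t0.
  have d2 : is_derive t 1 (fun u : R => expR (- u)) (- expR (- t)).
    have d3 : is_derive t 1 (fun u : R => - u) (- 1) by apply: is_derive_eq.
    have := @is_derive1_comp R expR (fun u => - u) t _ _ (is_derive_expR _) d3.
    by move=> H; apply: is_derive_eq; rewrite /GRing.scale /= ?mulN1r ?mulrN1.
  have -> : gker (x + 1) = (fun t => t `^ x * expR (- t)).
    by apply/funext => u; rewrite /gker addrK.
  by apply: is_derive_eq; rewrite /GRing.scale /= /gker; ring.
(* The derivative of gker (x + 1) - 2 M h. *)
pose f t := x * gker x t - gker (x + 1) t + M * h t.
have f_ge t : 0 < t -> x * gker x t <= f t by move=> /le_M; rewrite /f -addrA lerDl; lra.
have cker0 : gker (x + 1) t @[t --> 0^'+] --> 0.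
  rewrite -[X in _ --> X](mul0r (expR (- 0))).
  have -> : gker (x + 1) = (fun t => t `^ x * expR (- t)).
    by apply/funext => u; rewrite /gker addrK.
  apply: cvgM; first exact: powR_cvg0.
  apply: cvg_at_right_filter.
  by apply: continuous_comp; [exact: opp_continuous|exact: continuous_expR].
have h0 : h t @[t --> 0^'+] --> (1 : R).
  apply: cvg_at_right_filter.
  by have := @continuous_h 0; rewrite /continuous_at {2}/h mul0r oppr0 expR0.
have ckery : gker (x + 1) t @[t --> +oo] --> 0.
  apply: (@squeeze_cvgr _ _ _ _ (cst 0) (fun t => M * h t)); [|exact: cvg_cst|].
    near=> t; have t0 : 0 < t by near: t; exact: nbhs_pinfty_gt.
    by rewrite /cst gker_ge0 le_M.
  by rewrite -[X in _ --> X](mulr0 M); apply: cvgM h_cvgy; exact: cvg_cst.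
have If : (\int[mu]_(t in `]0%R, +oo[) (f t)%:E = (2 * M)%:E)%E.
  rewrite -[2 * M]opprK -sub0r.
  apply: (@ge0_FTC2_oy _ (fun t => gker (x + 1) t - (2 * M) * h t)).
  - move=> t t0; apply: le_trans (f_ge _ t0).
    by rewrite mulr_ge0// ltW.
  - move=> t t0; apply: continuousD; first apply: continuousB.
    + by apply: continuousM; [exact: cst_continuous|exact: continuous_gker].
    + exact: continuous_gker.
    + by apply: continuousM; [exact: cst_continuous|exact: continuous_h].
  - move=> t t0; have d1 := dker t t0; have d2 := derive_h t.
    by apply: is_derive_eq; rewrite /f /GRing.scale /=; field.
  - rewrite -[X in _ --> X]sub0r -[X in _ --> _ - X]mulr1; apply: cvgB => //.
    by apply: cvgM => //; exact: cvg_cst.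
  - rewrite -[X in _ --> X](subr0 0) -[X in _ --> _ - X](mulr0 (2 * M)); apply: cvgB => //.
    by apply: cvgM => //; exact: cvg_cst.
have mxk : measurable_fun (`]0, +oo[ : set R) (fun t => x * gker x t).
  exact: measurable_funM.
have mf : measurable_fun (`]0, +oo[ : set R) f.
  by apply: measurable_funD => //; apply: measurable_funB.
have Ik : (\int[mu]_(t in `]0%R, +oo[) (x * gker x t)%:E =
           x%:E * \int[mu]_(t in `]0%R, +oo[) (gker x t)%:E)%E.
  under eq_integral do rewrite EFinM.
  rewrite ge0_integralZl//.
  - exact: mx.
  - by move=> t _; rewrite lee_fin.
  - by rewrite lee_fin ltW.
have E : (\int[mu]_(t in `]0%R, +oo[) (gker (x + 1) t)%:E =
       x%:E * \int[mu]_(t in `]0%R, +oo[) (gker x t)%:E)%E.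
  have : (\int[mu]_(t in `]0%R, +oo[) ((x * gker x t)%:E + (M * h t)%:E) =
          \int[mu]_(t in `]0%R, +oo[) ((f t)%:E + (gker (x + 1) t)%:E))%E.
    by apply: eq_integral => t _; rewrite -!EFinD; congr EFin; rewrite /f; ring.
  rewrite (@ge0_integralD _ _ _ mu _ _ (fun t => (x * gker x t)%:E)
    (fun t => (M * h t)%:E)); first last.
  - exact: mMhE.
  - by move=> t _; rewrite lee_fin mulr_ge0// expR_ge0.
  - exact/measurable_EFinP.
  - by move=> t _; rewrite lee_fin mulr_ge0// ltW.
  - exact: measurable_itv.
  rewrite (@ge0_integralD _ _ _ mu _ _ (fun t => (f t)%:E)
    (fun t => (gker (x + 1) t)%:E)); first last.
  - exact: mx.
  - by move=> t _; rewrite lee_fin.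
  - exact/measurable_EFinP.
  - move=> t; rewrite /= in_itv /= andbT => t0; rewrite lee_fin.
    by apply: le_trans (f_ge _ t0); rewrite mulr_ge0// ltW.
  - exact: measurable_itv.
  rewrite integral_h// If Ik [RHS]addeC => /(congr1 (fun y => y - (2 * M)%:E)%E).
  by rewrite !addeK.
split => //; move: Gx1f; rewrite E; case: (integral _ _ _) => [r //||].
  by rewrite gt0_muley ?lte_fin.
by rewrite gt0_muleNy ?lte_fin.
Unshelve. all: by end_near. Qed.

Lemma Gamma_int x : Gamma x = fine (\int[mu]_(t in `]0%R, +oo[) (gker x t)%:E)%E.
Proof. by []. Qed.

Lemma GammaD1 x : 0 < x -> Gamma (x + 1) = x * Gamma x.
Proof. by move=> /Gamma_integral[fG E]; rewrite !Gamma_int E fineM. Qed.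

Lemma Gamma_gt0 x : 0 < x -> 0 < Gamma x.
Proof.
move=> x0; have [fG _] := Gamma_integral x0.
pose c := expR (- `|x - 1|) * expR (- 2).
suff : (c%:E <= \int[mu]_(t in `]0%R, +oo[) (gker x t)%:E)%E.
  rewrite -[X in (_ <= X)%E]fineK// lee_fin -Gamma_int; apply: lt_le_trans.
  by rewrite mulr_gt0 ?expR_gt0.
apply: (@le_trans _ _ (\int[mu]_(t in `[1%R, 2%R]) (gker x t)%:E)%E); last first.
  apply: ge0_subset_integral => //=.
  - apply/measurable_EFinP; exact: measurable_gker.
  - by move=> t _; rewrite lee_fin.
  - by move=> t; rewrite /= !in_itv /= andbT => /andP[t1 _]; exact: lt_le_trans t1.
have -> : c%:E = (\int[mu]_(t in `[1%R, 2%R]) (cst c%:E t))%E.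
  rewrite integral_cst//= lebesgue_measure_itv /= lte_fin ltr1n -EFinB.
  by rewrite [X in (_ * X%:E)%E](_ : _ = 1) ?mule1//; ring.
apply: ge0_le_integral => //=.
- by move=> t _; rewrite lee_fin mulr_ge0 ?expR_ge0.
- apply/measurable_EFinP; apply: measurable_funS (measurable_gker x) => // t.
  by rewrite /= !in_itv /= andbT => /andP[t1 _]; exact: lt_le_trans t1.
move=> t; rewrite in_itv /= => /andP[t1 t2]; rewrite lee_fin.
have t0 : 0 < t by exact: lt_le_trans t1.
rewrite /gker ler_pM ?expR_ge0 ?ler_expR ?lerN2//.
rewrite /powR gt_eqF// ler_expR.
have l0 : 0 <= ln t by rewrite ln_ge0.
have l1 : ln t <= 1.
  have : ln (1 + (t - 1)) <= t - 1 by rewrite le_ln1Dx//; lra.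
  by rewrite addrC subrK; lra.
have := normr_ge0 (x - 1); have := ler_norm (- (x - 1)); rewrite normrN.
by move: `|x - 1| => n ? ?; nra.
Qed.

End Gamma.

(** * Entire series *)

Section Series.
Variable R : realType.
Local Notation C := R[i].
Local Notation nC := (@Normc.normc R).
Implicit Types (c : nat -> R) (z : C).

Lemma normC_nC z : `|z| = (nC z)%:C. Proof. by []. Qed.

Lemma nC_ge0 z : 0 <= nC z.
Proof. by case: z => a b; exact: sqrtr_ge0. Qed.

Lemma nC_real (x : R) : nC x%:C = `|x|.
Proof. by rewrite /= expr0n /= addr0 sqrtr_sqr. Qed.

Lemma nCX z n : nC (z ^+ n) = nC z ^+ n.
Proof.
elim: n => [|n IH]; first by rewrite !expr0 Normc.normc1.
by rewrite !exprS Normc.normcM IH.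
Qed.

Lemma nC_sum (I : Type) (r : seq I) (P : pred I) (u : I -> C) :
  nC (\sum_(i <- r | P i) u i) <= \sum_(i <- r | P i) nC (u i).
Proof.
elim/big_rec2: _ => [|i x y _ IH]; first by rewrite Normc.normc0.
by apply: le_trans (le_normcD _ _) _; rewrite lerD2l.
Qed.

Lemma nC_distC z1 z2 : nC (z1 - z2) = nC (z2 - z1).
Proof. by rewrite -normcN opprB. Qed.

Lemma nC_tri z1 z2 z3 : nC (z1 - z3) <= nC (z1 - z2) + nC (z2 - z3).
Proof. by apply: le_trans (le_normcD _ _); rewrite addrA subrK. Qed.

Lemma nC_Re z : `|complex.Re z| <= nC z.
Proof. by rewrite -lecR -normC_nC; exact: normc_ge_Re. Qed.

Lemma nC_Im z : `|complex.Im z| <= nC z.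
Proof.
by case: z => a b; rewrite /= -sqrtr_sqr ler_sqrt ?addr_ge0 ?sqr_ge0// lerDr sqr_ge0.
Qed.

Lemma nC_le_ReIm z : nC z <= `|complex.Re z| + `|complex.Im z|.
Proof.
rewrite -lecR -normC_nC [z in `|z|]complexE; apply: le_trans (ler_normD _ _) _.
rewrite normrM !normC_nC !nC_real rmorphD /= lerD2l.
by rewrite /= expr0n expr1n /= add0r sqrtr1 mul1r.
Qed.

Lemma cvgC_nC (T : Type) (F : set_system T) {FF : Filter F} (u : T -> C^o) (l : C) :
  (nC (u t - l) @[t --> F] --> (0 : R)) -> u t @[t --> F] --> (l : C^o).
Proof.
move=> H; apply/cvgrPdist_lt => e e0.
have [e' e'0 ->] : exists2 e' : R, 0 < e' & e = e'%:C.
  move: e0; rewrite ltcE => /andP[/eqP/= ie re]; exists (complex.Re e) => //.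
  by rewrite [e in LHS]complexE ie mulr0 addr0.
move/cvgrPdist_lt: H => /(_ _ e'0); apply: filterS => t.
rewrite sub0r normrN ger0_norm ?nC_ge0// normC_nC ltcR => h.
by rewrite nC_distC.
Qed.

(** Any explicit bound of the remainders that tends to 0 identifies the sum. *)
Lemma Csum_eq (u : nat -> C) (l : C) (v : nat -> R) :
  (forall n, nC (l - \sum_(0 <= k < n) u k) <= v n) -> v n @[n --> \oo] --> 0 ->
  Csum u = l.
Proof.
move=> uv v0.
have H : series (u : nat -> C^o) n @[n --> \oo] --> (l : C^o).
  apply: cvgC_nC; apply: (@squeeze_cvgr _ _ _ _ (cst 0) v) v0; last exact: cvg_cst.
  by apply: nearW => n; rewrite nC_ge0 nC_distC uv.
exact: (cvg_lim (@norm_hausdorff _ _) H).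
Qed.

Lemma le_of_cvg0 (x y : R) (v : nat -> R) N :
  (forall n, (N <= n)%N -> x <= v n + y) -> v n @[n --> \oo] --> 0 -> x <= y.
Proof.
move=> H v0; rewrite -[y]add0r.
have c : (v n + y) @[n --> \oo] --> 0 + y by apply: cvgD => //; exact: cvg_cst.
by apply: (cvgr_to_ge c); exists N => // n /= Nn; exact: H.
Qed.

Lemma cvg_dist0 (v : nat -> R) (l : R) :
  v n @[n --> \oo] --> l -> `|v n - l| @[n --> \oo] --> (0 : R).
Proof.
move=> vl; rewrite -(@normr0 _ R) -(subrr l).
by apply: cvg_norm; apply: cvgB => //; exact: cvg_cst.
Qed.

(** The remainders of the exponential series dominate those of all the series
    below. *)
Definition etail (x : R) (N : nat) : R := expR x - \sum_(0 <= k < N) x ^+ k / k`!%:R.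

Lemma etail_cvg x : etail x n @[n --> \oo] --> 0.
Proof.
rewrite -(subrr (expR x)); apply: cvgB; first exact: cvg_cst.
exact: is_cvg_series_exp_coeff.
Qed.

Lemma Aetail_cvg A x : A * etail x n @[n --> \oo] --> 0.
Proof. by rewrite -(mulr0 A); apply: cvgM; [exact: cvg_cst|exact: etail_cvg]. Qed.

Lemma etail_sum x N M : (N <= M)%N -> 0 <= x ->
  \sum_(N <= k < M) x ^+ k / k`!%:R <= etail x N.
Proof.
move=> NM x0; apply: (@le_of_cvg0 _ _ (fun n => - etail x n) M) => [n Mn|]; last first.
  by rewrite -oppr0; apply: cvgN; exact: etail_cvg.
have -> : - etail x n + etail x N =
    \sum_(0 <= k < n) x ^+ k / k`!%:R - \sum_(0 <= k < N) x ^+ k / k`!%:R.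
  by rewrite /etail; lra.
rewrite (big_cat_nat (leq0n N) (leq_trans NM Mn)) /= addrAC subrr add0r.
rewrite (big_cat_nat NM Mn) /= lerDl.
by apply: sumr_ge0 => k _; rewrite divr_ge0// exprn_ge0.
Qed.

Definition pser c z : C := Csum (fun n => (c n)%:C * z ^+ n).

Definition psum c z N : C := \sum_(0 <= n < N) (c n)%:C * z ^+ n.

Definition exp_bounded (A K : R) c := forall n, `|c n| <= A * K ^+ n / n`!%:R.

Lemma psum_dist A K c z N M : exp_bounded A K c -> 0 <= A -> 0 <= K -> (N <= M)%N ->
  nC (psum c z M - psum c z N) <= A * etail (K * nC z) N.
Proof.
move=> cb A0 K0 NM; rewrite /psum (big_cat_nat (leq0n N) NM) /= addrAC subrr add0r.
apply: le_trans (nC_sum _ _ _) _.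
apply: le_trans (ler_wpM2l A0 (etail_sum NM _)); last by rewrite mulr_ge0 ?nC_ge0.
rewrite mulr_sumr; apply: ler_sum => n _.
rewrite Normc.normcM nCX nC_real exprMn !mulrA [leRHS]mulrAC.
by rewrite ler_wpM2r ?exprn_ge0 ?nC_ge0.
Qed.

(** Completeness of the complex plane, from that of the real line applied to
    the real and imaginary parts. *)
Lemma psum_lim A K c z : exp_bounded A K c -> 0 <= A -> 0 <= K ->
  exists l : C, psum c z n @[n --> \oo] --> (l : C^o).
Proof.
move=> cb A0 K0.
have reim (f : C -> R) : (forall x y, f (x - y) = f x - f y) ->
    (forall x, `|f x| <= nC x) -> exists l : R, f (psum c z n) @[n --> \oo] --> l.
  move=> fB fle; apply/cvg_ex; apply/cauchy_cvgP/cauchy_exP => e e0.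
  have cA := Aetail_cvg A (K * nC z).
  have [N _ HN] := cvgr_lt _ cA e e0.
  exists (f (psum c z N)); exists N => // n /= Nn.
  rewrite -ball_normE /= distrC -fB; apply: le_lt_trans (fle _) _.
  exact: le_lt_trans (psum_dist z cb A0 K0 Nn) (HN _ (leqnn N)).
have [a Ha] := reim (@complex.Re R) ltac:(by case=> ? ? [? ?]) nC_Re.
have [b Hb] := reim (@complex.Im R) ltac:(by case=> ? ? [? ?]) nC_Im.
exists (a +i* b); apply: cvgC_nC.
apply: (@squeeze_cvgr _ _ _ _ (cst 0) (fun n => `|complex.Re (psum c z n) - a|
    + `|complex.Im (psum c z n) - b|)); last 2 first.
- exact: cvg_cst.
- by rewrite -[X in _ --> X](addr0 0); apply: cvgD; exact: cvg_dist0.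
apply: nearW => n; rewrite nC_ge0 /=; apply: le_trans (nC_le_ReIm _) _.
by case: (psum c z n).
Qed.

Lemma nC_cvg (u : nat -> C) (l : C) : (u n : C^o) @[n --> \oo] --> (l : C^o) ->
  nC (u n - l) @[n --> \oo] --> (0 : R).
Proof.
move=> H; apply/cvgrPdist_lt => e e0.
have e0' : 0 < e%:C by rewrite ltcR.
move/cvgrPdist_lt: H => /(_ _ e0'); apply: filterS => n.
by rewrite normC_nC ltcR sub0r normrN ger0_norm ?nC_ge0// nC_distC.
Qed.

Lemma pser_tail A K c z N : exp_bounded A K c -> 0 <= A -> 0 <= K ->
  nC (pser c z - psum c z N) <= A * etail (K * nC z) N.
Proof.
move=> cb A0 K0; have [l Hl] := psum_lim z cb A0 K0.
have tl M : nC (l - psum c z M) <= A * etail (K * nC z) M.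
  apply: (@le_of_cvg0 _ _ (fun n => nC (psum c z n - l)) M); last exact: nC_cvg.
  move=> n Mn; rewrite nC_distC.
  apply: le_trans (nC_tri _ (psum c z n) _) _.
  rewrite addrC lerD//.
  by rewrite nC_distC; exact: psum_dist.
rewrite /pser (@Csum_eq _ l (fun N => A * etail (K * nC z) N))//.
exact: Aetail_cvg.
Qed.

Lemma pser_eq c z (l : C) (v : nat -> R) :
  (forall n, nC (l - psum c z n) <= v n) -> v n @[n --> \oo] --> 0 -> pser c z = l.
Proof. exact: Csum_eq. Qed.

Lemma pser_finite c z N : (forall n, (N <= n)%N -> c n = 0) -> pser c z = psum c z N.
Proof.
move=> c0; have e n : (N <= n)%N -> psum c z n = psum c z N.
  move=> Nn; rewrite /psum (big_cat_nat (leq0n N) Nn) /= [X in _ + X]big_nat_cond.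
  rewrite [X in _ + X]big1 ?addr0// => k.
  by rewrite andbT => /andP[Nk _]; rewrite c0// mul0r.
apply: (@pser_eq _ _ _ (fun n => nC (psum c z N - psum c z n))) => //.
by apply: cvg_near_cst; exists N => // n /= /e ->; rewrite subrr Normc.normc0.
Qed.

(** Tannery's theorem: the heads converge termwise, and the tails are uniformly
    small. *)
Lemma pser_dominated A K (cc : nat -> nat -> R) c z :
  (forall m, exp_bounded A K (cc m)) -> 0 <= A -> 0 <= K ->
  (forall n, cc m n @[m --> \oo] --> c n) ->
  nC (pser (cc m) z - pser c z) @[m --> \oo] --> (0 : R).
Proof.
move=> cb A0 K0 cc_c.
have cbl : exp_bounded A K c.
  move=> n; apply: (cvgr_to_le (cvg_norm (cc_c n))); apply: nearW => m; exact: cb.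
apply/cvgrPdist_lt => e e0.
have e3 : 0 < e / 3 by rewrite divr_gt0.
have [N _ /(_ _ (leqnn N)) /= HN] := cvgr_lt _ (Aetail_cvg A (K * nC z)) _ e3.
pose s m := \sum_(0 <= n < N) `|cc m n - c n| * nC z ^+ n.
have s0 : s m @[m --> \oo] --> 0.
  have -> : (0 : R) = \sum_(0 <= n < N) (0 * nC z ^+ n).
    by rewrite big1// => n _; rewrite mul0r.
  rewrite /s; apply: cvg_big => [|n _]; first exact: add_continuous.
  apply: cvgM; last exact: cvg_cst.
  exact/cvg_dist0/cc_c.
have [N2 _ H2] := cvgr_lt _ s0 _ e3; exists N2 => // m /= /H2 /= sm.
rewrite sub0r normrN ger0_norm ?nC_ge0//.
have h1 := le_lt_trans (pser_tail z N (cb m) A0 K0) HN.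
have h2 := le_lt_trans (pser_tail z N cbl A0 K0) HN.
have h3 : nC (psum (cc m) z N - psum c z N) <= s m.
  rewrite /psum -sumrB; apply: le_trans (nC_sum _ _ _) _.
  apply: ler_sum => n _; rewrite -mulrBl -rmorphB Normc.normcM nCX nC_real.
  exact: lexx.
have := nC_tri (pser (cc m) z) (psum (cc m) z N) (pser c z).
have := nC_tri (psum (cc m) z N) (psum c z N) (pser c z).
rewrite (nC_distC (psum c z N)); lra.
Qed.

End Series.

(** * Termwise derivation *)

Section Deriv.
Variable R : realType.
Local Notation C := R[i].
Local Notation nC := (@Normc.normc R).
Implicit Types (c : nat -> R) (z : C).

Lemma natrC n : (n%:R : C) = (n%:R : R)%:C.
Proof. by rewrite rmorph_nat. Qed.

Lemma nC_nat n : nC n%:R = n%:R.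
Proof. by rewrite natrC nC_real ger0_norm. Qed.

Lemma exp_bounded_diffs A K c : exp_bounded A K c -> exp_bounded (A * K) K (pseries_diffs c).
Proof.
move=> cb n; rewrite /pseries_diffs normrM ger0_norm//.
apply: le_trans (ler_wpM2l _ (cb n.+1)) _ => //.
rewrite factS natrM invfM exprS le_eqVlt; apply/orP; left; apply/eqP.
have n1 : (n.+1%:R : R) != 0 by rewrite pnatr_eq0.
have nf : (n`!%:R : R) != 0 by rewrite pnatr_eq0 -lt0n fact_gt0.
by move: n1 nf; move: n.+1%:R n`!%:R => a b a0 b0; field; rewrite a0 b0.
Qed.

Lemma exprD_remainder (h z : C) (r : R) n : nC z + nC h <= r -> 1 <= r ->
  nC ((h + z) ^+ n - z ^+ n - h * (n%:R * z ^+ n.-1)) <= nC h ^+ 2 * (4 * r) ^+ n.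
Proof.
move=> zhr r1; have r0 : 0 <= r by exact: le_trans r1.
have zr : nC z <= r by apply: le_trans zhr; rewrite lerDl nC_ge0.
elim: n => [|n IH].
  by rewrite !expr0 subrr mul0r mulr0 subr0 Normc.normc0 mulr1 sqr_ge0.
set E := (X in nC X) in IH.
have -> : (h + z) ^+ n.+1 - z ^+ n.+1 - h * (n.+1%:R * z ^+ n.+1.-1) =
    (h + z) * E + h ^+ 2 * (n%:R * z ^+ n.-1).
  rewrite /E; case: n {IH E} => [|n] /=; first by rewrite !expr0 !expr1; ring.
  by rewrite !exprS -[n.+2]addn1 -[n.+1]addn1 !natrD; ring.
apply: le_trans (le_normcD _ _) _.
rewrite Normc.normcM (Normc.normcM (h ^+ 2)) (Normc.normcM n%:R) !nCX nC_nat.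
have hz : nC (h + z) <= r by apply: le_trans (le_normcD _ _) _; rewrite addrC.
have H1 : nC (h + z) * nC E <= r * (nC h ^+ 2 * (4 * r) ^+ n).
  by apply: ler_pM => //; exact: nC_ge0.
have H2 : n%:R * nC z ^+ n.-1 <= (4 * r) ^+ n.
  rewrite exprMn; apply: ler_pM => //.
  - by rewrite exprn_ge0 ?nC_ge0.
  - by rewrite -natrX ler_nat; apply/ltnW/ltn_expl.
  - apply: (@le_trans _ _ (r ^+ n.-1)); first by rewrite lerXn2r ?nnegrE ?nC_ge0.
    exact: ler_weXn2l (leq_pred n).
have H3 := ler_wpM2l (sqr_ge0 (nC h)) H2.
apply: le_trans (lerD H1 H3) _.
set X := (4 * r) ^+ n in H1 H2 H3 *.
have X0 : 0 <= X by rewrite /X exprn_ge0// mulr_ge0.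
rewrite [(4 * r) ^+ n.+1]exprS -/X.
have := mulr_ge0 (sqr_ge0 (nC h)) X0; set Y := nC h ^+ 2 * X => Y0.
have -> : nC h ^+ 2 * (4 * r * X) = 4 * (r * Y) by rewrite /Y; ring.
have : Y <= r * Y by rewrite ler_peMl.
by lra.
Qed.

Lemma psum_diffs c z N :
  psum (pseries_diffs c) z N = \sum_(0 <= n < N.+1) (c n)%:C * (n%:R * z ^+ n.-1).
Proof.
rewrite big_nat_recl// mul0r mulr0 add0r; apply: eq_bigr => n _.
by rewrite /pseries_diffs rmorphM rmorph_nat /=; ring.
Qed.

Lemma psum_remainder A K c (h z : C) (r : R) N : exp_bounded A K c -> 0 <= A -> 0 <= K ->
  nC z + nC h <= r -> 1 <= r ->
  nC (psum c (h + z) N.+1 - psum c z N.+1 - h * psum (pseries_diffs c) z N)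
    <= nC h ^+ 2 * (A * expR (K * (4 * r))).
Proof.
move=> cb A0 K0 zhr r1; have r0 : 0 <= r by exact: le_trans r1.
rewrite psum_diffs /psum mulr_sumr -!sumrB; apply: le_trans (nC_sum _ _ _) _.
have H : \sum_(0 <= k < N.+1) (K * (4 * r)) ^+ k / k`!%:R <= expR (K * (4 * r)).
  have := @etail_sum R (K * (4 * r)) 0 N.+1 (leq0n _).
  by rewrite /etail [X in _ - X]big_geq// subr0; apply; rewrite !mulr_ge0.
apply: le_trans (ler_wpM2l (sqr_ge0 _) (ler_wpM2l A0 H)).
rewrite !mulr_sumr; apply: ler_sum => n _.
have -> : (c n)%:C * (h + z) ^+ n - (c n)%:C * z ^+ n - h * ((c n)%:C * (n%:R * z ^+ n.-1))
  = (c n)%:C * ((h + z) ^+ n - z ^+ n - h * (n%:R * z ^+ n.-1)).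
  by rewrite !mulrBr [h * (_ * _)]mulrCA.
rewrite Normc.normcM nC_real.
apply: le_trans (ler_pM _ _ (cb n) (exprD_remainder n zhr r1)) _ => //.
  exact: nC_ge0.
rewrite [(K * _) ^+ n]exprMn; move: ((4 * r) ^+ n) => X.
by rewrite le_eqVlt; apply/orP; left; apply/eqP; ring.
Qed.

Lemma pser_remainder A K c (h z : C) (r : R) : exp_bounded A K c -> 0 <= A -> 0 <= K ->
  nC z + nC h <= r -> 1 <= r ->
  nC (pser c (h + z) - pser c z - h * pser (pseries_diffs c) z)
    <= nC h ^+ 2 * (A * expR (K * (4 * r))).
Proof.
move=> cb A0 K0 zhr r1; set B := _ * _.
pose v N := A * etail (K * nC (h + z)) N.+1 + A * etail (K * nC z) N.+1
  + nC h * (A * K * etail (K * nC z) N).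
apply: (@le_of_cvg0 _ _ _ v 0) => [n _|]; last first.
  have -> : (0 : R) = 0 + 0 + nC h * 0 by rewrite mulr0 !addr0.
  apply: cvgD; first apply: cvgD.
  - by have := Aetail_cvg A (K * nC (h + z)); rewrite -cvg_shiftS.
  - by have := Aetail_cvg A (K * nC z); rewrite -cvg_shiftS.
  - by apply: cvgM; [exact: cvg_cst|exact: Aetail_cvg].
have := psum_remainder n cb A0 K0 zhr r1; rewrite -/B => HB.
have h1 := pser_tail (h + z) n.+1 cb A0 K0.
have h2 := pser_tail z n.+1 cb A0 K0.
have h3 := pser_tail z n (exp_bounded_diffs cb) (mulr_ge0 A0 K0) K0.
have h4 := ler_wpM2l (nC_ge0 h) h3; rewrite -Normc.normcM in h4.
have -> : pser c (h + z) - pser c z - h * pser (pseries_diffs c) z =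
  ((pser c (h + z) - psum c (h + z) n.+1) + - (pser c z - psum c z n.+1)
   + - (h * (pser (pseries_diffs c) z - psum (pseries_diffs c) z n)))
  + (psum c (h + z) n.+1 - psum c z n.+1 - h * psum (pseries_diffs c) z n) by ring.
apply: le_trans (le_normcD _ _) _; apply: lerD => //.
apply: le_trans (le_normcD _ _) _; rewrite /v normcN; apply: lerD => //.
by apply: le_trans (le_normcD _ _) _; rewrite normcN; apply: lerD.
Qed.

(** The remainder of order 1 is O(h^2), as it is so uniformly for the partial
    sums. *)
Lemma Cderive_pser A K c z : exp_bounded A K c -> 0 <= A -> 0 <= K ->
  Cderive (pser c) z = pser (pseries_diffs c) z.
Proof.
move=> cb A0 K0; set l := pser (pseries_diffs c) z.
pose M := A * expR (K * (4 * (nC z + 1))).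
have M0 : 0 <= M by rewrite mulr_ge0 ?expR_ge0.
have H : h^-1 *: ((pser c : C -> C^o) (h + z) - (pser c : C -> C^o) z)
    @[h --> (0 : C^o)^'] --> (l : C^o).
  apply: cvgC_nC.
  have nC0 : nC h @[h --> (0 : C^o)^'] --> (0 : R).
    apply/cvgrPdist_lt => e e0.
    have e0' : 0 < e%:C by rewrite ltcR.
    near=> h; have : `|h| < e%:C by near: h; exact: (@dnbhs0_lt C C^o).
    by rewrite normC_nC ltcR sub0r normrN ger0_norm ?nC_ge0.
  apply: (@squeeze_cvgr _ _ _ _ (cst 0) (fun h => nC h * M)); last 2 first.
  - exact: cvg_cst.
  - by rewrite -[X in _ --> X](mul0r M); apply: cvgM => //; exact: cvg_cst.
  near=> h; rewrite nC_ge0 /=.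
  have h0 : h != 0 by near: h; exact: (@nbhs_dnbhs_neq C^o).
  have h1 : nC h < 1.
    rewrite -ltcR -normC_nC; near: h; apply: (@dnbhs0_lt C C^o); exact: ltr01.
  have nh0 : 0 < nC h.
    rewrite lt_neqAle nC_ge0 andbT eq_sym; apply: contra h0 => /eqP.
    by move=> /Normc.eq0_normc ->.
  have := @pser_remainder A K c h z (nC z + 1) cb A0 K0.
  rewrite lerD2l (ltW h1) lerDr nC_ge0 => /(_ isT isT); rewrite -/l -/M.
  have -> : pser c (h + z) - pser c z - h * l = h * (h^-1 *: (pser c (h + z) - pser c z) - l).
    by rewrite mulrBr /GRing.scale /= mulrA mulfV// mul1r.
  by rewrite Normc.normcM expr2 -mulrA ler_pM2l.
exact: (cvg_lim (@norm_hausdorff _ _) H).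
Unshelve. all: by end_near. Qed.

End Deriv.

(** * Products of series, and the product of the two Bessel series *)

Section Cauchy.
Variable R : realType.
Local Notation C := R[i].
Local Notation nC := (@Normc.normc R).
Implicit Types (a b c : nat -> R) (z : C).

Lemma nC_lim_unique (u : nat -> C) (l1 l2 : C) :
  nC (u n - l1) @[n --> \oo] --> (0 : R) -> nC (u n - l2) @[n --> \oo] --> (0 : R) ->
  l1 = l2.
Proof.
move=> u1 u2; apply/eqP; rewrite -subr_eq0; apply/eqP/Normc.eq0_normc.
apply/eqP; rewrite eq_le nC_ge0 andbT.
apply: (@le_of_cvg0 _ _ _ (fun n => nC (u n - l1) + nC (u n - l2)) 0) => [n _|].
  by rewrite addr0; apply: le_trans (nC_tri _ (u n) _) _; rewrite nC_distC.
by rewrite -[X in _ --> X](addr0 0); apply: cvgD.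
Qed.

Lemma pser_poly (p : {poly R}) z :
  pser (fun n => p`_n) z = (map_poly (real_complex R) p).[z].
Proof.
rewrite (@pser_finite _ _ _ (size p)) => [|n]; last exact: nth_default.
rewrite horner_coef size_map_poly /psum big_mkord.
by apply: eq_bigr => i _; rewrite coef_map.
Qed.

Lemma psum_poly c z N : psum c z N = (map_poly (real_complex R) (\poly_(i < N) c i)).[z].
Proof.
rewrite -pser_poly (@pser_finite _ _ _ N) => [|n Nn].
  by apply: eq_big_nat => n /andP[_ nN]; rewrite coef_poly nN.
by rewrite coef_poly ltnNge Nn.
Qed.

Definition cauchy_prod a b n := \sum_(k < n.+1) a k * b (n - k)%N.

Lemma exp_bounded_cauchy_prod A K B L a b : exp_bounded A K a -> exp_bounded B L b -> 
  exp_bounded (A * B) (L + K) (cauchy_prod a b).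
Proof.
move=> ha hb n; apply: le_trans (ler_norm_sum _ _ _) _.
rewrite exprDn mulr_sumr mulr_suml; apply: ler_sum => i _.
rewrite normrM; apply: le_trans (ler_pM _ _ (ha i) (hb _)) _ => //.
have ni : (i <= n)%N by rewrite -ltnS.
rewrite -[_ *+ 'C(_, _)]mulr_natr -(bin_fact ni) !natrM !invfM.
rewrite le_eqVlt; apply/orP; left; apply/eqP.
have : ('C(n, i)%:R : R) != 0 by rewrite pnatr_eq0 -lt0n bin_gt0.
have : (i`!%:R : R) != 0 by rewrite pnatr_eq0 -lt0n fact_gt0.
have : ((n - i)`!%:R : R) != 0 by rewrite pnatr_eq0 -lt0n fact_gt0.
move: (K ^+ i) (L ^+ (n - i)) (i`!%:R) ((n - i)`!%:R) ('C(n, i)%:R) => x y p q r hp hq hr.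
by field; rewrite hp hq hr.
Qed.

Lemma exp_bounded_trunc A K c N : exp_bounded A K c ->
  exp_bounded A K (fun n => (\poly_(i < N) c i)`_n).
Proof.
move=> h n; rewrite coef_poly; case: ifP => // _.
by apply: le_trans (h n); rewrite normr0.
Qed.

Lemma psum_cvg A K c z : exp_bounded A K c -> 0 <= A -> 0 <= K ->
  nC (psum c z m - pser c z) @[m --> \oo] --> (0 : R).
Proof.
move=> h A0 K0.
apply: (@squeeze_cvgr _ _ _ _ (cst 0) (fun m => A * etail (K * nC z) m)); last 2 first.
- exact: cvg_cst.
- exact: Aetail_cvg.
by apply: nearW => m; rewrite nC_ge0 /= nC_distC pser_tail.
Qed.

Lemma nC_cvgM (u v : nat -> C) (x y : C) :
  nC (u n - x) @[n --> \oo] --> (0 : R) -> nC (v n - y) @[n --> \oo] --> (0 : R) ->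
  nC (u n * v n - x * y) @[n --> \oo] --> (0 : R).
Proof.
move=> ux vy.
apply: (@squeeze_cvgr _ _ _ _ (cst 0) (fun n => nC (u n - x) * nC (v n - y)
  + nC x * nC (v n - y) + nC (u n - x) * nC y)); last 2 first.
- exact: cvg_cst.
- have -> : (0 : R) = 0 * 0 + nC x * 0 + 0 * nC y by rewrite mulr0 mul0r mulr0 !addr0.
  by apply: cvgD; [apply: cvgD|]; apply: cvgM => //; exact: cvg_cst.
apply: nearW => n; rewrite nC_ge0 /=.
have -> : u n * v n - x * y = (u n - x) * (v n - y) + x * (v n - y) + (u n - x) * y by ring.
apply: le_trans (le_normcD _ _) _; rewrite -!Normc.normcM lerD2r.
exact: le_normcD.
Qed.

(** The products of the truncated series are polynomials whose coefficients are
    dominated and eventually equal to those of the Cauchy product. *)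
Lemma pserM A K B L a b z : exp_bounded A K a -> exp_bounded B L b ->
  0 <= A -> 0 <= K -> 0 <= B -> 0 <= L ->
  pser a z * pser b z = pser (cauchy_prod a b) z.
Proof.
move=> ha hb A0 K0 B0 L0.
pose cc m n := (\poly_(i < m) a i * \poly_(i < m) b i)`_n.
have cb m : exp_bounded (A * B) (L + K) (cc m).
  move=> n.
  have := exp_bounded_cauchy_prod (exp_bounded_trunc m ha) (exp_bounded_trunc m hb) n.
  by rewrite /cc /cauchy_prod coefM.
have H := @pser_dominated _ _ _ cc (cauchy_prod a b) z cb (mulr_ge0 A0 B0) (addr_ge0 L0 K0).
have {}H : nC (pser (cc m) z - pser (cauchy_prod a b) z) @[m --> \oo] --> (0 : R).
  apply: H => n; apply: cvg_near_cst; exists n.+1 => // m /= nm.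
  rewrite /cc coefM; apply: eq_bigr => i _.
  have im : (i < m)%N by exact: leq_trans (ltn_ord i) nm.
  by rewrite !coef_poly im (leq_ltn_trans (leq_subr _ _) nm).
apply: nC_lim_unique H; under eq_cvg do rewrite /cc pser_poly rmorphM hornerM -!psum_poly.
by apply: nC_cvgM; [exact: psum_cvg ha _ _|exact: psum_cvg hb _ _].
Qed.

Lemma etail_anti (x : R) N M : 0 <= x -> (N <= M)%N -> etail x M <= etail x N.
Proof.
move=> x0 NM; rewrite /etail lerD2l lerN2 (big_cat_nat (leq0n N) NM) /= lerDl.
by apply: sumr_ge0 => k _; rewrite divr_ge0// exprn_ge0.
Qed.

Lemma pser_even A K c z : exp_bounded A K c -> 0 <= A -> 0 <= K ->
  (forall n, c n.*2.+1 = 0) -> pser c z = pser (fun n => c n.*2) (z ^+ 2).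
Proof.
move=> h A0 K0 c0; apply/esym.
apply: (@pser_eq _ _ _ _ (fun n => A * etail (K * nC z) n)); last exact: Aetail_cvg.
move=> n; have -> : psum (fun n => c n.*2) (z ^+ 2) n = psum c z n.*2.
  elim: n => [|n IH]; first by rewrite /psum !big_geq.
  rewrite doubleS /psum !big_nat_recr//= -!/(psum _ _ _) IH c0 mul0r addr0.
  by rewrite -exprM mul2n.
apply: le_trans (pser_tail z n.*2 h A0 K0) _; apply: ler_wpM2l => //.
by apply: etail_anti; [rewrite mulr_ge0 ?nC_ge0|rewrite -addnn leq_addr].
Qed.

End Cauchy.

Lemma recurrence_factor_gt0 (R : realFieldType) (t x : R) : 0 < t -> 0 <= x ->
  0 < (x + 2) * (t + x + 1) * (x + 2 * t) * (t + x).
Proof. by move=> t0 x0; rewrite !mulr_gt0//; lra. Qed.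

Section Coefficients.
Variables (R : realType) (t : R).
Hypothesis t0 : 0 < t.
Local Notation ph := (pochhammer t).
Implicit Types a b g : nat -> R.

(** The coefficients of J and I as series in (z/2)^2, without the factor
    (z/2)^nu / Gamma(nu + 1). *)
Definition jcoef n : R := (-1) ^+ n / (n`!%:R * ph n).
Definition icoef n : R := 1 / (n`!%:R * ph n).

Lemma pochhammer0 : ph 0 = 1. Proof. by rewrite /pochhammer big_ord0. Qed.

Lemma pochhammerS n : ph n.+1 = ph n * (t + n%:R).
Proof. by rewrite /pochhammer big_ord_recr. Qed.

Lemma pochhammer_gt0 n : 0 < ph n.
Proof. by rewrite prodr_gt0// => i _; rewrite ltr_wpDr. Qed.

Lemma tD_neq0 n : t + n%:R != 0.
Proof. by rewrite gt_eqF// ltr_wpDr. Qed.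

(** With theta = x d/dx, the series j and i with these coefficients satisfy
   theta (theta + t - 1) j = - x j and theta (theta + t - 1) i = x i. Hence the
   products h = j i, kk = (theta j)(theta i) and m = (theta j) i - j (theta i)
   satisfy the first order relations [rel1], [rel2] and [rel3], from which kk
   and m are eliminated in [relh]. *)
Let wt n : R := n%:R * (n%:R + (t - 1)).

Let wt_j n : wt n.+1 * jcoef n.+1 = - jcoef n.
Proof.
rewrite /wt /jcoef factS natrM pochhammerS exprS.
have := tD_neq0 n; have := lt0r_neq0 (pochhammer_gt0 n).
have : (n`!%:R : R) != 0 by rewrite pnatr_eq0 -lt0n fact_gt0.
have : (n.+1%:R : R) != 0 by rewrite pnatr_eq0.
rewrite -[n.+1]addn1 natrD.
move: (n`!%:R) (ph n) ((-1) ^+ n) (n%:R) => f p s x h1 h2 h3 h4.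
by field; rewrite h1 h2 h3 h4.
Qed.

Let wt_i n : wt n.+1 * icoef n.+1 = icoef n.
Proof.
rewrite /wt /icoef factS natrM pochhammerS.
have := tD_neq0 n; have := lt0r_neq0 (pochhammer_gt0 n).
have : (n`!%:R : R) != 0 by rewrite pnatr_eq0 -lt0n fact_gt0.
have : (n.+1%:R : R) != 0 by rewrite pnatr_eq0.
rewrite -[n.+1]addn1 natrD.
move: (n`!%:R) (ph n) (n%:R) => f p x h1 h2 h3 h4.
by field; rewrite h1 h2 h3 h4.
Qed.

Let wj n := wt n * jcoef n.
Let wi n := wt n * icoef n.
Let kj n := n%:R * jcoef n.
Let ki n := n%:R * icoef n.

Let cauchy_prod_wj g n : cauchy_prod wj g n.+1 = - cauchy_prod jcoef g n.
Proof.
rewrite /cauchy_prod big_ord_recl {1}/wj /wt !mul0r add0r -sumrN.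
by apply: eq_bigr => i _; rewrite /wj lift0 subSS wt_j mulNr.
Qed.

Let cauchy_prod_wi g n : cauchy_prod g wi n.+1 = cauchy_prod g icoef n.
Proof.
rewrite /cauchy_prod big_ord_recr /= {2}/wi subnn /wt !mul0r mulr0 addr0.
by apply: eq_bigr => i _; rewrite /wi subSn ?wt_i// -ltnS.
Qed.

Let h := cauchy_prod jcoef icoef.
Let kk := cauchy_prod kj ki.
Let m n := cauchy_prod kj icoef n - cauchy_prod jcoef ki n.

Let rel1 n : n.+1%:R * (n.+1%:R + (t - 1)) * h n.+1 = 2 * kk n.+1.
Proof.
apply/eqP; rewrite -subr_eq0; apply/eqP.
transitivity (cauchy_prod wj icoef n.+1 + cauchy_prod jcoef wi n.+1); last first.
  by rewrite cauchy_prod_wj cauchy_prod_wi addNr.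
rewrite /h /kk /cauchy_prod !mulr_sumr -sumrB -big_split /=; apply: eq_bigr => k _.
have /(congr1 (fun x => x%:R : R)) : (n.+1 = k + (n.+1 - k))%N by rewrite subnKC// -ltnS.
rewrite natrD => ->; rewrite /wj /wi /kj /ki /wt.
by move: (jcoef _) (icoef _) (k%:R) ((n.+1 - k)%N%:R) => x y u v; ring.
Qed.

Let rel2 n : (n.+1%:R + 2 * (t - 1)) * kk n.+1 = m n.
Proof.
transitivity (cauchy_prod wj ki n.+1 + cauchy_prod kj wi n.+1); last first.
  by rewrite cauchy_prod_wj cauchy_prod_wi addrC.
rewrite /kk /cauchy_prod !mulr_sumr -big_split /=; apply: eq_bigr => k _.
have /(congr1 (fun x => x%:R : R)) : (n.+1 = k + (n.+1 - k))%N by rewrite subnKC// -ltnS.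
rewrite natrD => ->; rewrite /wj /wi /kj /ki /wt.
by move: (jcoef _) (icoef _) (k%:R) ((n.+1 - k)%N%:R) => x y u v; ring.
Qed.

Let rel3 n : (n.+1%:R + (t - 1)) * m n.+1 = - (2 * h n).
Proof.
transitivity (cauchy_prod wj icoef n.+1 - cauchy_prod jcoef wi n.+1); last first.
  by rewrite cauchy_prod_wj cauchy_prod_wi /h; ring.
rewrite /m /cauchy_prod -!sumrB !mulr_sumr; apply: eq_bigr => k _.
have /(congr1 (fun x => x%:R : R)) : (n.+1 = k + (n.+1 - k))%N by rewrite subnKC// -ltnS.
rewrite natrD => ->; rewrite /wj /wi /kj /ki /wt.
by move: (jcoef _) (icoef _) (k%:R) ((n.+1 - k)%N%:R) => x y u v; ring.
Qed.

Let relh n : (n%:R + 2) * (t + n%:R + 1) * (n%:R + 2 * t) * (t + n%:R) * h n.+2 = - (4 * h n).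
Proof.
have c1 : n.+1%:R = n%:R + 1 :> R by rewrite natr1.
have c2 : n.+2%:R = n%:R + 2 :> R by rewrite -addn2 natrD.
have r1 := rel1 n.+1; have r2 := rel2 n.+1; have r3 := rel3 n.
rewrite c2 in r1 r2; rewrite c1 in r3.
have e1 : 2 * kk n.+2 = (n%:R + 2) * (t + n%:R + 1) * h n.+2 by rewrite -r1; ring.
have e2 : m n.+1 = (n%:R + 2 * t) * kk n.+2 by rewrite -r2; ring.
have e3 : (t + n%:R) * m n.+1 = - (2 * h n) by rewrite -r3; ring.
transitivity (2 * ((t + n%:R) * ((n%:R + 2 * t) * kk n.+2))).
  transitivity ((t + n%:R) * (n%:R + 2 * t) * (2 * kk n.+2)); last by ring.
  by rewrite e1; ring.
by rewrite -e2 e3; ring.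
Qed.

Lemma cauchy_prod_ji_odd n : cauchy_prod jcoef icoef n.*2.+1 = 0.
Proof.
elim: n => [|n IH].
  rewrite /cauchy_prod big_ord_recl big_ord1 /= /jcoef /icoef pochhammerS pochhammer0.
  rewrite /= expr0 expr1 mul1r addr0; field.
  by rewrite fact0 oner_eq0 gt_eqF.
rewrite doubleS; have := relh n.*2.+1; rewrite /h IH mulr0 oppr0 => /eqP.
by rewrite mulf_eq0 => /orP[|/eqP//]; rewrite gt_eqF ?recurrence_factor_gt0.
Qed.

Lemma cauchy_prod_ji_even n :
  cauchy_prod jcoef icoef n.*2 = (-1) ^+ n / (n`!%:R * ph n * ph n.*2).
Proof.
elim: n => [|n IH].
  by rewrite /cauchy_prod big_ord1 /= /jcoef /icoef pochhammer0 fact0 expr0; field.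
rewrite doubleS; have := relh n.*2; rewrite /h IH !pochhammerS factS natrM.
move: (cauchy_prod _ _ _) => H.
have := tD_neq0 n.*2; have := tD_neq0 n.*2.+1; have := tD_neq0 n.
have := lt0r_neq0 (pochhammer_gt0 n); have := lt0r_neq0 (pochhammer_gt0 n.*2).
have : (n`!%:R : R) != 0 by rewrite pnatr_eq0 -lt0n fact_gt0.
have : (n.+1%:R : R) != 0 by rewrite pnatr_eq0.
rewrite exprS -[n.+1]addn1 -[n.*2.+1]addn1 !natrD -muln2 !natrM.
move: (n`!%:R) (ph n) (ph _) ((-1) ^+ n) (n%:R) => f p q s x h1 h2 h3 h4 h5 h6 h7 E.
have h8 : (x * 2 + 2) * (t + x * 2 + 1) * (x * 2 + 2 * t) * (t + x * 2) != 0.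
  rewrite (_ : _ * _ = 4 * ((x + 1) * (t + (x * 2 + 1)) * (t + x) * (t + x * 2))).
    by rewrite !mulf_neq0// pnatr_eq0.
  by ring.
apply: (mulfI h8); rewrite E; field.
by rewrite h1 h2 h3 h4 h5 h6 h7.
Qed.

End Coefficients.

(** * Complex powers and w as a power series *)

Section Powers.
Variable R : realType.
Local Notation C := R[i].
Local Notation nC := (@Normc.normc R).
Implicit Types (z : C) (a x y : R).

Definition cis x : C := cos x +i* sin x.

Lemma cisD x y : cis (x + y) = cis x * cis y.
Proof. by rewrite /cis cosD sinD; apply/eqP; rewrite eq_complex /= eqxx /= addrC. Qed.

Lemma cis0 : cis 0 = 1.
Proof. by rewrite /cis cos0 sin0. Qed.

Lemma cisMn x n : cis (x *+ n) = cis x ^+ n.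
Proof. by elim: n => [|n IH]; rewrite ?mulr0n ?cis0// mulrS cisD IH exprS. Qed.

Lemma nC_cis x : nC (cis x) = 1.
Proof. by rewrite /= cos2Dsin2 sqrtr1. Qed.

Lemma nC_gt0 z : z != 0 -> 0 < nC z.
Proof.
move=> z0; rewrite lt_neqAle nC_ge0 andbT eq_sym.
by apply: contra z0 => /eqP/Normc.eq0_normc ->.
Qed.

Lemma CpowrE z a : Cpowr z a = (nC z `^ a)%:C * cis (a * Carg z).
Proof. by []. Qed.

Lemma Carg_polar z : z != 0 -> z = (nC z)%:C * cis (Carg z).
Proof.
move=> z0; have n0 := nC_gt0 z0; have n0' := lt0r_neq0 n0.
case: z z0 n0 n0' => a b z0 n0 n0'; set n := nC _ in n0 n0' *.
have n2 : n ^+ 2 = a ^+ 2 + b ^+ 2 by rewrite /n /= sqr_sqrtr// addr_ge0 ?sqr_ge0.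
have an : -1 <= a / n <= 1.
  rewrite -ler_norml normrM normfV (gtr0_norm n0) ler_pdivrMr// mul1r.
  exact: (nC_Re (a +i* b)).
pose t := acos (a / n).
have ct : cos t = a / n by rewrite /t acosK// in_itv.
have st : sin t = `|b| / n.
  rewrite /t sin_acos// -[RHS]ger0_norm ?divr_ge0 ?(ltW n0)// -sqrtr_sqr; congr Num.sqrt.
  rewrite !expr_div_n real_normK ?num_real//.
  have -> : b ^+ 2 = n ^+ 2 - a ^+ 2 by rewrite n2; ring.
  by field.
rewrite /Carg /= -/n -/t; apply/eqP; rewrite eq_complex /=.
case: (lerP 0 b) => b0; rewrite ?cosN ?sinN ct st ?(ger0_norm b0) ?(ltr0_norm b0);
  apply/andP; split; apply/eqP; by field.
Qed.

Lemma Carg_bounds z : - pi <= Carg z <= pi.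
Proof.
rewrite /Carg; set u := complex.Re z / _.
have u1 : -1 <= u <= 1.
  have [z0|z0] := eqVneq z 0.
    by rewrite /u z0 /= mul0r; apply/andP; split; lra.
  have n0 := nC_gt0 z0.
  rewrite -ler_norml /u normrM normfV (gtr0_norm n0) ler_pdivrMr// mul1r.
  exact: nC_Re.
have := acos_ge0 u1; have := acos_lepi u1.
by move: (acos u) => v v1 v0; case: ifP => _; lra.
Qed.

(** Uniqueness of the principal argument. *)
Lemma Carg_cis (r x : R) : 0 < r -> - pi < x < pi -> Carg (r%:C * cis x) = x.
Proof.
move=> r0 /andP[x1 x2]; rewrite /Carg.
rewrite Normc.normcM nC_cis mulr1 nC_real gtr0_norm//= !mul0r subr0 addr0.
rewrite mulrAC mulfV ?gt_eqF// mul1r pmulr_rge0//.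
case: (lerP 0 x) => x0.
  by rewrite sin_ge0_pi ?x0 ?(ltW x2)// cosK// in_itv /= x0 ltW.
have : 0 < sin (- x) by rewrite sin_gt0_pi// oppr_gt0 x0 ltrNl.
rewrite sinN oppr_gt0 ltNge => /negbTE ->.
rewrite -cosN cosK ?opprK// in_itv /= oppr_ge0 ltW//=; lra.
Qed.

Lemma CpowrDn z a n : z != 0 -> Cpowr z (a + n%:R) = Cpowr z a * z ^+ n.
Proof.
move=> z0; have n0 := nC_gt0 z0.
rewrite !CpowrE powRD; last by rewrite (gt_eqF n0) implybT.
rewrite (powR_mulrn n (nC_ge0 z)) mulrDl cisD.
have -> : z ^+ n = (nC z ^+ n)%:C * cis (Carg z) ^+ n.
  by rewrite {1}(Carg_polar z0) exprMn rmorphXn.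
by rewrite mulr_natl cisMn rmorphM mulrACA.
Qed.

Lemma Cpowr_quarter z : z != 0 ->
  [/\ nC (Cpowr z (1 / 4) / 2) = nC z `^ (1 / 4) / 2
    & Carg (Cpowr z (1 / 4) / 2) = Carg z / 4].
Proof.
move=> z0; have n0 := nC_gt0 z0.
have p0 : 0 < nC z `^ (1 / 4) by exact: powR_gt0.
have -> : Cpowr z (1 / 4) / 2 = (nC z `^ (1 / 4) / 2)%:C * cis (Carg z / 4).
  rewrite CpowrE rmorphM fmorphV rmorph_nat mulrAC; congr (_ * cis _).
  by rewrite mulrC mul1r.
split.
  by rewrite Normc.normcM nC_cis mulr1 nC_real gtr0_norm ?divr_gt0.
rewrite Carg_cis ?divr_gt0//.
have /andP[c1 c2] := Carg_bounds z; have := pi_gt0 R.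
by move=> ?; apply/andP; split; lra.
Qed.

Lemma Cpowr_quarterX z : z != 0 -> (Cpowr z (1 / 4) / 2) ^+ 4 = z / 16.
Proof.
move=> z0; have n0 := nC_gt0 z0; set x := _ / 2.
have [xn xa] := Cpowr_quarter z0; rewrite -/x in xn xa.
have x0 : x != 0.
  apply/eqP => E; move: xn; rewrite E Normc.normc0 => /esym/eqP.
  by rewrite gt_eqF// divr_gt0 ?powR_gt0.
rewrite (Carg_polar x0) exprMn -rmorphXn -cisMn xn xa.
have -> : (nC z `^ (1 / 4) / 2) ^+ 4 = nC z / 16.
  rewrite expr_div_n -powR_mulrn ?powR_ge0// -powRrM.
  by rewrite (_ : 1 / 4 * 4 = 1) ?powRr1 ?nC_ge0//; [congr (_ / _); ring|field].
have -> : Carg z / 4 *+ 4 = Carg z by rewrite -mulr_natr; field.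
by rewrite rmorphM fmorphV rmorph_nat mulrAC -Carg_polar.
Qed.

(** The arguments add up to that of z exactly, as the one of the fourth root is
    a quarter of it. *)
Lemma Cpowr_cancel nu z : z != 0 ->
  (2 `^ (2 * nu))%:C * Cpowr z (- nu / 2 + 1) * Cpowr (Cpowr z (1 / 4) / 2) nu ^+ 2 = z.
Proof.
move=> z0; have n0 := nC_gt0 z0; have [xn xa] := Cpowr_quarter z0.
rewrite [Cpowr (_ / _) nu]CpowrE xn xa exprMn -cisMn -rmorphXn CpowrE.
rewrite [RHS](Carg_polar z0).
have -> : (2 `^ (2 * nu))%:C * ((nC z `^ (- nu / 2 + 1))%:C * cis ((- nu / 2 + 1) * Carg z)) *
  (((nC z `^ (1 / 4) / 2) `^ nu ^+ 2)%:C * cis (nu * (Carg z / 4) *+ 2)) =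
  (2 `^ (2 * nu) * nC z `^ (- nu / 2 + 1) * (nC z `^ (1 / 4) / 2) `^ nu ^+ 2)%:C *
  (cis ((- nu / 2 + 1) * Carg z) * cis (nu * (Carg z / 4) *+ 2)).
  by rewrite !rmorphM /=; ring.
congr (_%:C * _); last first.
  by rewrite -cisD; congr cis; rewrite -mulr_natr; field.
have n0' := gt_eqF n0.
have e2 : 2^-1 `^ nu = (2 `^ nu)^-1 :> R.
  by rewrite -powR_inv1// -powRrM mulN1r powRN.
have e3 : 2 `^ (2 * nu) = (2 `^ nu) ^+ 2 :> R.
  by rewrite mulrC powRrM powR_mulrn ?powR_ge0.
have e4 : (nC z `^ (1 / 4) `^ nu) ^+ 2 = nC z `^ (nu / 2).
  by rewrite -powR_mulrn ?powR_ge0// -!powRrM; congr powR; field.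
have e5 : nC z `^ (- nu / 2 + 1) * nC z `^ (nu / 2) = nC z.
  rewrite -powRD ?n0' ?implybT//.
  by rewrite (_ : - nu / 2 + 1 + nu / 2 = 1) ?powRr1 ?nC_ge0//; field.
rewrite powRM ?powR_ge0 ?invr_ge0// exprMn e2 e3 e4 -[RHS]e5.
have : (2 `^ nu : R) != 0 by rewrite gt_eqF// powR_gt0.
by move: (2 `^ nu) (nC z `^ _) (nC z `^ _) => p q r p0; field.
Qed.

Lemma Csum_scale (k : C) (u : nat -> C) (l : C) (v : nat -> R) :
  (forall n, nC (l - \sum_(0 <= i < n) u i) <= v n) -> v n @[n --> \oo] --> 0 ->
  Csum (fun n => k * u n) = k * l.
Proof.
move=> uv v0; apply: (@Csum_eq _ _ _ (fun n => nC k * v n)) => [n|].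
  by rewrite -mulr_sumr -mulrBr Normc.normcM ler_wpM2l ?nC_ge0.
by rewrite -(mulr0 (nC k)); apply: cvgM => //; exact: cvg_cst.
Qed.

End Powers.

Section BesselW.
Variables (R : realType) (nu : R).
Hypothesis hnu : -1 < nu.
Local Notation C := R[i].
Local Notation nC := (@Normc.normc R).
Local Notation t := (nu + 1).
Local Notation ph := (pochhammer t).

Let t0 : 0 < t. Proof. by rewrite -ltrBlDr sub0r. Qed.

Lemma inv_pochhammer_le n : (ph n)^-1 <= 1 + t^-1.
Proof.
case: n => [|n]; first by rewrite pochhammer0 invr1 lerDl invr_ge0 ltW.
apply: (@le_trans _ _ t^-1); last by rewrite lerDr.
rewrite lef_pV2 ?posrE ?pochhammer_gt0//.
elim: n => [|n IH]; first by rewrite pochhammerS pochhammer0 mul1r addr0.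
rewrite pochhammerS; apply: le_trans IH _; rewrite ler_peMr ?(ltW (pochhammer_gt0 t0 _))//.
by rewrite -[n.+1%:R]natr1 addrA lerDr addr_ge0 ?(ltW t0).
Qed.

Lemma Gamma_shift n : Gamma (nu + n%:R + 1) = Gamma t * ph n.
Proof.
elim: n => [|n IH]; first by rewrite addr0 pochhammer0 mulr1.
have -> : nu + n.+1%:R + 1 = (nu + n%:R + 1) + 1 by rewrite -addn1 natrD; ring.
rewrite GammaD1; last by rewrite addrAC ltr_wpDr.
by rewrite IH pochhammerS; ring.
Qed.

Let B := 1 + t^-1.
Let B0 : 0 <= B. Proof. by rewrite addr_ge0 ?invr_ge0 ?ltW. Qed.

Lemma exp_bounded_jcoef : exp_bounded B 1 (jcoef t).
Proof.
move=> n; rewrite /jcoef normrM normrX normrN1 expr1n mul1r mulr1 ger0_norm.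
  by rewrite invfM mulrC ler_wpM2r ?invr_ge0// inv_pochhammer_le.
by rewrite invr_ge0 mulr_ge0// ltW// pochhammer_gt0.
Qed.

Lemma exp_bounded_icoef : exp_bounded B 1 (icoef t).
Proof.
move=> n; rewrite /icoef mul1r expr1n mulr1 ger0_norm.
  by rewrite invfM mulrC ler_wpM2r ?invr_ge0// inv_pochhammer_le.
by rewrite invr_ge0 mulr_ge0// ltW// pochhammer_gt0.
Qed.

Let bessel_series (s : R) (c : nat -> R) (z : C) : z != 0 ->
  (forall n, s ^+ n / (n`!%:R * Gamma (nu + n%:R + 1)) = (Gamma t)^-1 * c n) ->
  exp_bounded B 1 c ->
  Csum (fun n : nat => (s ^+ n / (n`!%:R * Gamma (nu + n%:R + 1)))%:C
      * Cpowr (z / 2) (nu + n.*2%:R)) =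
  Cpowr (z / 2) nu * (Gamma t)^-1%:C * pser c ((z / 2) ^+ 2).
Proof.
move=> z0 cE cb.
have z20 : z / 2 != 0 by rewrite mulf_neq0// invr_eq0 pnatr_eq0.
rewrite (_ : (fun n => _) = (fun n => (Cpowr (z / 2) nu * (Gamma t)^-1%:C) *
   ((c n)%:C * ((z / 2) ^+ 2) ^+ n))); last first.
  apply/funext => n; rewrite cE CpowrDn// -exprM mul2n rmorphM /=; ring.
apply: (@Csum_scale _ _ _ _ (fun n => B * etail (1 * nC ((z / 2) ^+ 2)) n)).
  by move=> n; apply: pser_tail.
exact: Aetail_cvg.
Qed.

Definition bcoef n : R := (-1) ^+ n / (n`!%:R * ph n * ph n.*2) / 16 ^+ n.

(** Only even powers of (z^(1/4)/2)^2 occur in the product J I, and (z^(1/4)/2)^4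
    is z/16, which removes the roots. *)
Lemma bessel_w_pser (z : C) : bessel_w nu z = z * pser bcoef z.
Proof.
have [->|z0] := eqVneq z 0.
  rewrite mul0r /bessel_w.
  have Cp0 (a : R) : a != 0 -> Cpowr 0 a = 0 :> C.
    by move=> a0; rewrite CpowrE Normc.normc0 powR0// mul0r.
  have [e|ne] := eqVneq (- nu / 2 + 1) 0; last by rewrite Cp0// mulr0 !mul0r.
  have nu2 : nu = 2 by lra.
  rewrite [bessel_prod _ _](_ : _ = 0) ?mulr0// /bessel_prod.
  rewrite [besselJ _ _](_ : _ = 0) ?mul0r// /besselJ.
  rewrite (Cp0 (1 / 4)) ?mul0r; last by rewrite gt_eqF// divr_gt0.
  apply: (@Csum_eq _ _ _ (cst 0)); last exact: cvg_cst.
  move=> n; rewrite big1 ?subr0 ?Normc.normc0// => k _.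
  by rewrite Cp0 ?mulr0// nu2 gt_eqF// ltr_wpDr.
have G0 := Gamma_gt0 t0; have G0' := lt0r_neq0 G0.
set x := Cpowr z (1 / 4).
have x0 : x != 0.
  apply/eqP => E; have [+ _] := Cpowr_quarter z0; rewrite -/x E mul0r Normc.normc0.
  by move/esym/eqP; rewrite gt_eqF// divr_gt0// powR_gt0 ?nC_gt0.
have HJ : besselJ nu x = Cpowr (x / 2) nu * (Gamma t)^-1%:C * pser (jcoef t) ((x / 2) ^+ 2).
  apply: bessel_series => //; last exact: exp_bounded_jcoef.
  by move=> n; rewrite Gamma_shift /jcoef !invfM; ring.
have HI : besselI nu x = Cpowr (x / 2) nu * (Gamma t)^-1%:C * pser (icoef t) ((x / 2) ^+ 2).
  have -> : besselI nu x = Csum (fun n => (1 ^+ n / (n`!%:R * Gamma (nu + n%:R + 1)))%:C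
      * Cpowr (x / 2) (nu + n.*2%:R)).
    by congr Csum; apply/funext => n; rewrite expr1n.
  apply: bessel_series => //; last exact: exp_bounded_icoef.
  by move=> n; rewrite Gamma_shift /icoef !invfM expr1n; ring.
have H11 : 0 <= 1 + 1 :> R by [].
have prodE : pser (jcoef t) ((x / 2) ^+ 2) * pser (icoef t) ((x / 2) ^+ 2) = pser bcoef z.
  rewrite (pserM _ exp_bounded_jcoef exp_bounded_icoef)//.
  rewrite (pser_even _ (exp_bounded_cauchy_prod exp_bounded_jcoef exp_bounded_icoef)
    (mulr_ge0 B0 B0) H11 (cauchy_prod_ji_odd t0)).
  rewrite -exprM Cpowr_quarterX//; congr Csum; apply/funext => n.
  rewrite cauchy_prod_ji_even// /bcoef expr_div_n.
  rewrite [in RHS]rmorphM /= fmorphV rmorphXn rmorph_nat.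
  by rewrite mulrA mulrAC.
rewrite /bessel_w /bessel_prod -/x HJ HI -prodE.
set P := pser (jcoef t) _; set Q := pser (icoef t) _.
rewrite -{2}(Cpowr_cancel nu z0) -/x.
have -> : (Gamma t)^-1%:C = ((Gamma t)%:C)^-1 :> C by rewrite fmorphV.
have : (Gamma t)%:C != 0 :> C by rewrite fmorph_eq0.
rewrite rmorphXn /=; move: ((Gamma t)%:C) => g g0; field.
exact: g0.
Qed.

Let B20 : 0 <= B * B. Proof. exact: mulr_ge0. Qed.

Lemma exp_bounded_bcoef : exp_bounded (B * B) 1 bcoef.
Proof.
move=> n; rewrite expr1n mulr1 /bcoef !normrM normrX normrN1 expr1n mul1r.
have p1 := inv_pochhammer_le n; have p2 := inv_pochhammer_le n.*2.
have q1 : 0 <= (ph n)^-1 by rewrite invr_ge0 ltW// pochhammer_gt0.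
have q2 : 0 <= (ph n.*2)^-1 by rewrite invr_ge0 ltW// pochhammer_gt0.
have -> : `|(n`!%:R * ph n * ph n.*2)^-1| * `|16 ^- n| =
    (ph n)^-1 * (ph n.*2)^-1 * 16 ^- n / n`!%:R.
  rewrite !ger0_norm ?invr_ge0 ?exprn_ge0 ?mulr_ge0 ?ltW ?pochhammer_gt0//.
  by rewrite !invfM; move: ((ph n)^-1) ((ph _)^-1) (16 ^- n) => u v w; ring.
rewrite ler_wpM2r ?invr_ge0// -[leRHS]mulr1.
apply: ler_pM => //; [exact: mulr_ge0|exact: ler_pM|].
by rewrite invf_le1 ?exprn_gt0// exprn_ege1// ler1n.
Qed.

(** The coefficients of w' and of (z w')'. *)
Definition gcoef n : R := n.+1%:R * bcoef n.
Definition dcoef n : R := n.+1%:R * gcoef n.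

Lemma exp_bounded_gcoef : exp_bounded (2 * (B * B)) 2 gcoef.
Proof.
move=> n; rewrite /gcoef normrM ger0_norm//.
have nb : n.+1%:R <= 2 * 2 ^+ n :> R.
  by rewrite -exprS -natrX ler_nat; apply/ltnW/ltn_expl.
have := exp_bounded_bcoef n; rewrite expr1n mulr1 => bn.
apply: le_trans (ler_pM _ _ nb bn) _ => //.
by rewrite le_eqVlt; apply/orP; left; apply/eqP; move: (2 ^+ n) (n`!%:R^-1) => u v; ring.
Qed.

Definition shift_coef (c : nat -> R) n : R := if n is m.+1 then c m else 0.

(** The Cauchy product with the series of the polynomial z. *)
Lemma pser_shift A K c (z : C) : exp_bounded A K c -> 0 <= A -> 0 <= K ->
  z * pser c z = pser (shift_coef c) z.
Proof.
move=> cb A0 K0; pose d n : R := (n == 1%N)%:R.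
have db : exp_bounded 1 1 d.
  move=> [|[|n]]; rewrite /d /= ?normr0 ?normr1 expr1n mulr1 ?divr1// .
have zE : z = pser d z.
  rewrite (@pser_finite _ _ _ 2) => [|[|[|n]]//].
  by rewrite /psum big_nat_recr// big_nat1 /d /= mul0r add0r mul1r.
rewrite {1}zE (pserM _ db cb)//; congr (pser _ _); apply/funext => -[|n] /=.
  by rewrite /cauchy_prod big_ord1 /d mul0r.
rewrite /cauchy_prod big_ord_recl big_ord_recl /d /= mul0r add0r mul1r subSS subn0.
rewrite big1 ?addr0//.
by move=> i _; rewrite mul0r.
Qed.

Lemma pserD A K L D a b (z : C) : exp_bounded A K a -> exp_bounded D L b ->
  0 <= A -> 0 <= K -> 0 <= D -> 0 <= L ->
  pser a z + pser b z = pser (fun n => a n + b n) z.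
Proof.
move=> ha hb A0 K0 D0 L0; apply/esym.
apply: (@pser_eq _ _ _ _ (fun n => A * etail (K * nC z) n + D * etail (L * nC z) n)).
  move=> n; rewrite /psum; under eq_bigr do rewrite rmorphD mulrDl.
  rewrite big_split /= -!/(psum _ _ _) opprD addrACA.
  apply: le_trans (le_normcD _ _) _; apply: lerD; exact: pser_tail.
by rewrite -[X in _ --> X](addr0 0); apply: cvgD; exact: Aetail_cvg.
Qed.

Lemma Cderive_bessel_w : Cderive (bessel_w nu) = pser gcoef.
Proof.
have -> : bessel_w nu = pser (shift_coef bcoef).
  by apply/funext => z; rewrite bessel_w_pser (pser_shift _ exp_bounded_bcoef).
have H : exp_bounded (B * B) 2 (shift_coef bcoef).
  move=> [|n]; first by rewrite normr0 mulr1 divr1.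
  apply: le_trans (exp_bounded_bcoef n) _; rewrite /= expr1n mulr1 -mulrA ler_wpM2l//.
  rewrite factS natrM invfM mulrA ler_peMl ?invr_ge0// ler_pdivlMr// mul1r.
  by rewrite -natrX ler_nat; apply/ltnW/ltn_expl.
by apply/funext => z; rewrite (Cderive_pser _ H).
Qed.

Lemma Cderive2_bessel_w z : z * Cderive (Cderive (bessel_w nu)) z + Cderive (bessel_w nu) z
  = pser dcoef z.
Proof.
have B2 : 0 <= 2 * (B * B) by exact: mulr_ge0.
rewrite Cderive_bessel_w (Cderive_pser _ exp_bounded_gcoef)//.
have H := exp_bounded_diffs exp_bounded_gcoef.
have H0 : 0 <= 2 * (B * B) * 2 by exact: mulr_ge0.
rewrite (pser_shift _ H)//.
have Hs : exp_bounded (2 * (B * B)) 4 (shift_coef (pseries_diffs gcoef)).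
  move=> [|n]; first by rewrite normr0 mulr1 divr1.
  rewrite /= /pseries_diffs normrM ger0_norm//.
  have nb : n.+1%:R <= 2 ^+ n.+1 :> R by rewrite -natrX ler_nat; apply/ltnW/ltn_expl.
  apply: le_trans (ler_pM _ _ nb (exp_bounded_gcoef n.+1)) _ => //.
  rewrite (_ : (4 : R) = 2 * 2) ?exprMn; last by rewrite -natrM.
  rewrite le_eqVlt; apply/orP; left; apply/eqP.
  by move: (2 ^+ n.+1) (n.+1`!%:R^-1) => u v; ring.
rewrite (pserD _ Hs exp_bounded_gcoef)//; congr (pser _ _); apply/funext => -[|n] /=.
  by rewrite add0r /dcoef mul1r.
by rewrite /pseries_diffs /dcoef -[n.+2%:R]natr1 mulrDl mul1r.
Qed.

End BesselW.

(** * Polynomials with positive real zeros *)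

(** The logarithmic derivative of a product. *)
Lemma prod1MX_deriv (F : fieldType) (s : seq F) (z : F) :
  (forall b, b \in s -> 1 - b * z != 0) ->
  z * (\prod_(b <- s) (1 - b *: 'X))^`().[z] =
  - (\prod_(b <- s) (1 - b *: 'X)).[z] * \sum_(b <- s) b * z / (1 - b * z).
Proof.
elim: s => [|b s IH] H; first by rewrite !big_nil derivC horner0 !mulr0.
have {}IH := IH (fun c cs => H c (mem_behead (s := b :: s) cs)).
have b0 := H b (mem_head _ _).
rewrite !big_cons derivM hornerD !hornerM mulrDr [X in _ + X]mulrCA IH.
rewrite derivB derivZ derivX (derivC 1) !hornerE; move: (\sum_(_ <- s) _) (_.[z]) => S P.
rewrite /=; field; exact: b0.
Qed.

Lemma horner_prod1MX (F : comNzRingType) (s : seq F) (z : F) :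
  (\prod_(b <- s) (1 - b *: 'X)).[z] = \prod_(b <- s) (1 - b * z).
Proof. by rewrite horner_prod; apply: eq_bigr => b _; rewrite !hornerE. Qed.

(** Newton's identity. The b are the inverses of the zeros. *)
Lemma powersum3 (F : comNzRingType) (s : seq F) :
  let q := \prod_(b <- s) (1 - b *: 'X) in
  q`_0 = 1 /\
  \sum_(b <- s) b ^+ 3 = - q`_1 ^+ 3 + 3 * q`_1 * q`_2 - 3 * q`_3.
Proof.
elim: s => [|b s [IH0 IH]] /=.
  by rewrite !big_nil !coef1 /=; split => //; ring.
rewrite !big_cons; set q := \prod_(_ <- s) _ in IH0 IH *.
have cE n : ((1 - b *: 'X) * q)`_n.+1 = q`_n.+1 - b * q`_n.
  by rewrite mulrBl mul1r coefB -scalerAl coefZ coefXM.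
split; first by rewrite mulrBl mul1r coefB -scalerAl coefZ coefXM /= mulr0 subr0.
by rewrite !cE IH IH0; ring.
Qed.

Lemma ler_sum_mem (F : numDomainType) (I : eqType) (s : seq I) (f g : I -> F) :
  (forall b, b \in s -> f b <= g b) -> \sum_(b <- s) f b <= \sum_(b <- s) g b.
Proof. by move=> fg; rewrite big_seq [leRHS]big_seq; apply: ler_sum. Qed.

Section Hyperbolic.
Variable R : realType.
Local Notation C := R[i].
Local Notation nC := (@Normc.normc R).
Local Notation toC := (real_complex R).

(** All complex zeros are positive real numbers, and p(0) = 1. Inverse zeros are
    listed, since they behave well when the degree grows. *)
Definition poszeros (p : {poly R}) :=
  exists2 s : seq R, (forall b, b \in s -> 0 < b) & p = \prod_(b <- s) (1 - b *: 'X).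

Lemma map_prod1MX (s : seq R) :
  map_poly toC (\prod_(b <- s) (1 - b *: 'X)) =
  \prod_(b <- [seq toC b | b <- s]) (1 - b *: 'X).
Proof.
rewrite rmorph_prod big_map; apply: eq_bigr => b _.
by rewrite rmorphB rmorph1 /= map_polyZ map_polyX.
Qed.

Lemma Im_inv (w : C) : complex.Im w^-1 = - complex.Im w / nC w ^+ 2.
Proof.
by case: w => a b /=; rewrite sqr_sqrtr ?addr_ge0 ?sqr_ge0// ?mulNr.
Qed.

Lemma Im_sum (I : eqType) (r : seq I) (f : I -> C) :
  complex.Im (\sum_(i <- r) f i) = \sum_(i <- r) complex.Im (f i).
Proof. by apply: (big_morph (@complex.Im R)) => // -[? ?] [? ?]. Qed.

(** The roots of p + d X p' off those of p solve 1 = d sum_b bz/(1 - bz). The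
    terms of the sum have an imaginary part of the sign of Im z, and they are
    nonpositive for z <= 0. *)
Lemma poszeros_root (s : seq R) (d : R) (z : C) : (forall b, b \in s -> 0 < b) -> 0 < d ->
  let p := \prod_(b <- s) (1 - b *: 'X) in
  root (map_poly toC (p + d *: ('X * p^`()))) z -> exists2 x, 0 < x & z = x%:C.
Proof.
move=> s0 d0 p; rewrite {}/p rmorphD /= map_polyZ /= rmorphM /= map_polyX -deriv_map.
rewrite map_prod1MX /root !hornerE /= -mulrA => /eqP.
set sC := map _ s.
have [/allP h|] := boolP (all (fun b => 1 - b * z != 0) sC); last first.
  move=> /allPn[c /mapP[b bs ->]]; rewrite negbK => /eqP bz _.
  have b0 := s0 b bs; have b0' : toC b != 0 by rewrite fmorph_eq0 gt_eqF.
  exists b^-1; first by rewrite invr_gt0.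
  rewrite fmorphV; apply: (mulfI b0'); rewrite mulfV//.
  by apply/esym/eqP; rewrite -subr_eq0 bz.
rewrite prod1MX_deriv// mulNr mulrN.
set P := (_.[z]); have P0 : P != 0.
  by rewrite /P horner_prod1MX prodf_seq_neq0; apply/allP => b /h.
move=> E.
have {E} E : \sum_(b <- sC) (b * z / (1 - b * z)) = (d^-1)%:C.
  rewrite fmorphV; apply: (mulfI (_ : toC d != 0)); first by rewrite fmorph_eq0 gt_eqF.
  rewrite mulfV ?fmorph_eq0 ?gt_eqF//; apply: (mulfI P0); rewrite mulr1.
  by apply/esym/eqP; rewrite -subr_eq0 mulrCA E.
rewrite big_map in E.
have ImE b : b \in s -> complex.Im (toC b * z / (1 - toC b * z)) =
    complex.Im z * (b / nC (1 - toC b * z) ^+ 2).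
  move=> bs; have /h b0 : toC b \in sC by apply/mapP; exists b.
  have -> : toC b * z / (1 - toC b * z) = (1 - toC b * z)^-1 - 1 by field.
  transitivity (complex.Im (1 - toC b * z)^-1).
    by case: (_^-1) => u v /=; rewrite oppr0 addr0.
  rewrite Im_inv mulrCA mulrA; congr (_ / _).
  by case: z {h E b0 P P0} => x y /=; ring.
have := congr1 (@complex.Im R) E; rewrite Im_sum /= (eq_big_seq _ ImE) -mulr_sumr => /eqP.
have nb b : b \in s -> 0 < nC (1 - toC b * z).
  by move=> bs; apply: nC_gt0; apply: h; apply/mapP; exists b.
rewrite mulf_eq0 => /orP[/eqP y0|]; last first.
  rewrite big_seq psumr_eq0 => [/allP se|b bs]; last first.
    by rewrite divr_ge0 ?sqr_ge0// ltW// s0.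
  suff s_nil : s = [::].
    move: E; rewrite s_nil big_nil => /eqP; rewrite eq_sym fmorph_eq0 invr_eq0.
    by rewrite gt_eqF.
  case: (s) s0 nb se => // b s' s0' nb' /(_ b (mem_head _ _)).
  rewrite mem_head /= gt_eqF//; apply: divr_gt0; first exact/s0'/mem_head.
  exact/exprn_gt0/nb'/mem_head.
have zE : z = toC (complex.Re z) by rewrite [LHS]complexE y0 mulr0 addr0.
exists (complex.Re z) => //; rewrite ltNge; apply/negP => x0.
have {}E : \sum_(b <- s) b * complex.Re z / (1 - b * complex.Re z) = d^-1.
  apply: (@complexI R); rewrite -E rmorph_sum; apply: eq_bigr => b _.
  by rewrite zE fmorph_div rmorphB rmorphM rmorph1.
have : d^-1 <= 0.
  rewrite -E big_seq; apply: sumr_le0 => b /s0 b0.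
  have bx : b * complex.Re z <= 0 by rewrite pmulr_rle0.
  by rewrite pmulr_lle0// invr_gt0; lra.
by rewrite leNgt invr_gt0 d0.
Qed.

(** The polynomial splits over the complex numbers, with positive roots by
    [poszeros_root]. *)
Lemma poszeros_op (p : {poly R}) (d : R) : poszeros p -> 0 <= d ->
  poszeros (p + d *: ('X * p^`())).
Proof.
move=> [s s0 pE]; rewrite le_eqVlt => /orP[/eqP <-|d0].
  by exists s => //; rewrite scale0r addr0.
set q := p + _; pose qC := map_poly toC q.
have q0 : q.[0] = 1.
  rewrite /q !hornerE /= mulr0 mul0r addr0 pE horner_prod1MX big1// => b _.
  by rewrite mulr0 subr0.
have qC0 : qC.[0] = 1 by rewrite /qC -(rmorph0 toC) horner_map q0 rmorph1.
have qCn0 : qC != 0 by apply: contra_eq_neq qC0 => ->; rewrite horner0 eq_sym oner_eq0.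
have [r rE] := closed_field_poly_normal qC.
have rr z : z \in r -> exists2 x, 0 < x & z = x%:C.
  move=> zr; apply: (poszeros_root s0 d0); rewrite -pE -/q -/qC rE rootZ ?lead_coef_eq0//.
  by rewrite root_prod_XsubC.
pose x (z : C) := (complex.Re z)^-1.
exists [seq x z | z <- r].
  by move=> b /mapP[z /rr[y y0 ->] ->]; rewrite invr_gt0.
apply: (map_poly_inj toC); rewrite -/qC map_prod1MX -map_comp.
have fact : \prod_(b <- [seq (toC \o x) z | z <- r]) (1 - b *: 'X) =
    (\prod_(z <- r) (- z^-1)) *: \prod_(z <- r) ('X - z%:P) :> {poly C}.
  rewrite -scaler_prod big_map; apply: eq_big_seq => z /rr[y y0 ->].
  have y0' : toC y != 0 by rewrite fmorph_eq0 gt_eqF.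
  rewrite /x /= fmorphV scalerBr !scaleNr opprK scale_polyC mulVf// addrC; congr (_ + _).
rewrite fact rE; congr (_ *: _).
have P0 : (\prod_(z <- r) ('X - z%:P)).[0] != 0 :> C.
  by apply: contra_eq_neq qC0 => P0; rewrite rE hornerZ P0 mulr0 eq_sym oner_eq0.
apply: (mulIf P0); rewrite -!hornerZ -rE -fact qC0 horner_prod1MX big1// => b _.
by rewrite mulr0 subr0.
Qed.

(** Each operator p + d X p' multiplies the coefficient of X^n by 1 + d n; the
    start is (1 - k X)^m. *)
Lemma poszeros_coef (m : nat) (k : R) (ds : seq R) : 0 < k -> (forall d, d \in ds -> 0 <= d) ->
  poszeros (\poly_(n < m.+1) ('C(m, n)%:R * (- k) ^+ n * \prod_(d <- ds) (1 + d * n%:R))).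
Proof.
move=> k0; elim: ds => [|d ds IH] ds0.
  exists (nseq m k); first by move=> b; rewrite mem_nseq => /andP[_ /eqP ->].
  have -> : \prod_(b <- nseq m k) (1 - b *: 'X) = (1 - k *: 'X) ^+ m :> {poly R}.
    by elim: (m) => [|n IHn]; rewrite ?big_nil ?expr0// big_cons IHn exprS.
  rewrite exprDn; apply/polyP => n; rewrite coef_poly big_nil mulr1 coef_sum.
  under eq_bigr do rewrite expr1n mul1r -scaleNr exprZn -scaler_nat coefZ coefZ coefXn.
  case: ltnP => nm.
    rewrite (bigD1 (Ordinal nm))//= eqxx mulr1 big1 ?addr0// => i /negP ni.
    case: eqVneq => [E|]; last by rewrite !mulr0.
    by case: ni; apply/eqP/val_inj.
  by rewrite big1// => i _; rewrite gtn_eqF ?mulr0// (leq_trans _ nm).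
have {}IH := IH (fun c cs => ds0 c (mem_behead (s := d :: ds) cs)).
have := poszeros_op IH (ds0 _ (mem_head _ _)); congr poszeros; apply/polyP => n.
rewrite coefD coefZ coefXM coef_deriv !coef_poly.
case: n => [|n] /=; first by rewrite mulr0 addr0 big_cons mulr0 addr0 mul1r.
by case: ifP => _; rewrite ?mul0rn ?mulr0 ?addr0// big_cons -mulr_natr; ring.
Qed.

Lemma horner_prod1MX_gt0 (s : seq R) (x : R) : (forall b, b \in s -> b * x < 1) ->
  0 < (\prod_(b <- s) (1 - b *: 'X)).[x].
Proof.
by move=> sx; rewrite horner_prod1MX big_seq prodr_gt0// => b /sx; rewrite subr_gt0.
Qed.

(** Rolle's theorem for X p between 0 and a zero of p. *)
Lemma poszeros_interlace (p : {poly R}) (s s' : seq R) (x : R) :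
  (forall b, b \in s -> 0 < b) -> p = \prod_(b <- s) (1 - b *: 'X) ->
  p + 'X * p^`() = \prod_(b <- s') (1 - b *: 'X) -> 0 < x ->
  (forall b, b \in s' -> b * x < 1) -> forall b, b \in s -> b * x < 1.
Proof.
move=> s0 pE qE x0 s'x b bs; have b0 := s0 b bs.
have ib0 : 0 < b^-1 by rewrite invr_gt0.
have pb : p.[b^-1] = 0.
  rewrite pE horner_prod1MX; apply/eqP; rewrite prodf_seq_eq0; apply/hasP; exists b => //=.
  by rewrite mulfV ?subrr// gt_eqF.
have [|c] := @poly_rolle R 0 b^-1 ('X * p) ib0; first by rewrite !hornerE /= pb mulr0.
rewrite in_itv /= derivM derivX mul1r qE => /andP[c0 cb] qc.
rewrite ltNge; apply/negP => bx.
suff : 0 < (\prod_(b <- s') (1 - b *: 'X)).[c] by rewrite qc ltxx.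
apply: horner_prod1MX_gt0 => e es.
have cx : c <= x by apply: le_trans (ltW cb) _; rewrite -[b^-1]mulr1 ler_pdivrMl.
have [e0|e0] := leP e 0; first by apply: le_lt_trans ltr01; rewrite mulr_le0_ge0// ltW.
by apply: le_lt_trans (s'x e es); rewrite ler_pM2l.
Qed.

(** Weierstrass' product inequality. *)
Lemma prod_1B_ge (s : seq R) (f : R -> R) : (forall b, b \in s -> 0 <= f b <= 1) ->
  1 - \sum_(b <- s) f b <= \prod_(b <- s) (1 - f b).
Proof.
elim: s => [|b s IH] fs; first by rewrite !big_nil subr0.
have {}IH := IH (fun c cs => fs c (mem_behead (s := b :: s) cs)).
have /andP[f0 f1] := fs b (mem_head _ _).
have S0 : 0 <= \sum_(b <- s) f b.
  rewrite big_seq sumr_ge0// => c cs.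
  by have /andP[] := fs c (mem_behead (s := b :: s) cs).
have f1' : 0 <= 1 - f b by rewrite subr_ge0.
rewrite !big_cons; apply: le_trans (ler_wpM2l f1' IH).
by move: (\sum_(_ <- s) _) S0 => S S0; nra.
Qed.

(** As (X p)' > 0 on [0, x], the sum of the br/(1 - br), which is - r p'(r)/p(r),
    is at most 1 at r = x. It is convex in r and vanishes at 0, so it is at most
    th for r <= th x, and its value at |z| bounds |z p'(z)/p(z)|. The factor th
    is what makes the estimate survive a passage to the limit. *)
Lemma poszeros_bound (p : {poly R}) (s' : seq R) (x th : R) (z : C) : poszeros p ->
  p + 'X * p^`() = \prod_(b <- s') (1 - b *: 'X) -> 0 < x ->
  (forall b, b \in s' -> b * x < 1) -> 0 <= th <= 1 -> nC z <= th * x ->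
  nC (z * (map_poly toC p^`()).[z]) <= th * nC (map_poly toC p).[z] /\
  1 - th <= nC (map_poly toC p).[z].
Proof.
move=> [s s0 pE] qE x0 s'x /andP[th0 th1] zx.
have sx := poszeros_interlace s0 pE qE x0 s'x.
have tx : th * x <= x by rewrite ler_piMl// ltW.
have rx := le_trans zx tx; set r := nC z in zx rx.
have r0 : 0 <= r by exact: nC_ge0.
have p0 : 0 < p.[x] by rewrite pE horner_prod1MX_gt0.
have S1 : \sum_(b <- s) b * x / (1 - b * x) <= 1.
  have : 0 < (p + 'X * p^`()).[x] by rewrite qE horner_prod1MX_gt0.
  rewrite !hornerE /= {2}pE prod1MX_deriv -?pE => [|b /sx]; last first.
    by rewrite -subr_gt0 => /gt_eqF ->.
  by rewrite mulNr -{1}[p.[x]]mulr1 -mulrBr pmulr_rgt0// subr_gt0 => /ltW.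
have br b : b \in s -> [/\ 0 < b, b * x < 1, b * r < 1 & b * r <= th * (b * x)].
  move=> bs; have b0 := s0 b bs; have bx := sx b bs; split => //.
    by apply: le_lt_trans bx; rewrite ler_pM2l.
  by rewrite mulrCA ler_pM2l.
have term b : b \in s -> b * r / (1 - b * r) <= th * (b * x / (1 - b * x)).
  move=> /br[b0 bx br1 brx].
  rewrite mulrA; apply: ler_pM => //; rewrite ?mulr_ge0 ?(ltW b0)//.
    by rewrite invr_ge0 subr_ge0 ltW.
  rewrite lef_pV2 ?posrE ?subr_gt0// lerD2l lerN2.
  by rewrite ler_pM2l.
have Sr : \sum_(b <- s) b * r / (1 - b * r) <= th.
  apply: le_trans (_ : th * \sum_(b <- s) b * x / (1 - b * x) <= _); last first.
    by rewrite ler_piMr.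
  by rewrite mulr_sumr; apply: ler_sum_mem.
have nb b : b \in s -> 1 - b * r <= nC (1 - toC b * z).
  move=> /br[b0 _ _ _]; rewrite lerBlDr.
  have -> : b * r = nC (toC b * z) by rewrite Normc.normcM nC_real gtr0_norm.
  by apply: le_trans (le_normcD _ _); rewrite subrK Normc.normc1.
have nz b : b \in s -> 1 - toC b * z != 0.
  move=> bs; have [_ _ br1 _] := br b bs; apply/eqP => E.
  by have := nb b bs; rewrite E Normc.normc0 leNgt subr_gt0 br1.
split.
  rewrite -deriv_map pE map_prod1MX prod1MX_deriv => [|b /mapP[c cs ->]]; last exact: nz.
  rewrite mulNr normcN Normc.normcM mulrC ler_wpM2r ?nC_ge0//.
  apply: le_trans (nC_sum _ _ _) _; apply: le_trans Sr; rewrite big_map.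
  apply: ler_sum_mem => b bs; have [b0 _ br1 _] := br b bs.
  rewrite Normc.normcM Normc.normcV Normc.normcM nC_real gtr0_norm// -/r.
  rewrite ler_wpM2l ?mulr_ge0 ?(ltW b0)// lef_pV2 ?posrE ?subr_gt0 ?nb// .
  by apply: lt_le_trans (nb b bs); rewrite subr_gt0.
rewrite pE map_prod1MX horner_prod1MX big_map.
have -> : nC (\prod_(b <- s) (1 - toC b * z)) = \prod_(b <- s) nC (1 - toC b * z).
  by apply: (big_morph nC); [exact: Normc.normcM|exact: Normc.normc1].
apply: (@le_trans _ _ (\prod_(b <- s) (1 - b * r))); last first.
  rewrite big_seq [leRHS]big_seq; apply: ler_prod => b bs; rewrite nb// andbT.
  by have [_ _ br1 _] := br b bs; rewrite subr_ge0 ltW.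
apply: le_trans (prod_1B_ge _) => [|b /br[b0 _ br1 _]]; last first.
  by rewrite mulr_ge0 ?(ltW b0)//= ltW.
rewrite lerD2l lerN2; apply: le_trans Sr; apply: ler_sum_mem => b /br[b0 _ br1 _].
rewrite ler_peMr ?mulr_ge0 ?(ltW b0)// invf_ge1 ?subr_gt0// gerBl.
by rewrite mulr_ge0 ?(ltW b0).
Qed.

(** The cube of the largest inverse zero is at most the sum of all cubes. *)
Lemma poszeros_first_root (s : seq R) (x : R) : (forall b, b \in s -> 0 < b) -> 0 < x ->
  let q := \prod_(b <- s) (1 - b *: 'X) in
  (- q`_1 ^+ 3 + 3 * q`_1 * q`_2 - 3 * q`_3) * x ^+ 3 < 1 ->
  forall b, b \in s -> b * x < 1.
Proof.
move=> s0 x0 q; have [_ <-] := powersum3 s => S b bs; have b0 := s0 b bs.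
rewrite -(@ltr_pXn2r _ 3) ?nnegrE ?mulr_ge0 ?(ltW b0) ?(ltW x0)// expr1n exprMn.
apply: le_lt_trans S; rewrite ler_pM2r ?exprn_gt0//.
rewrite (big_rem b)//= lerDl big_seq sumr_ge0// => c /mem_rem /s0 c0.
by rewrite exprn_ge0 ?ltW.
Qed.

End Hyperbolic.

(** * Lower bounds of the radius *)

Section Lower.
Variables (R : realType) (nu : R).
Hypothesis hnu : -1 < nu.
Local Notation C := R[i].
Local Notation nC := (@Normc.normc R).
Local Notation toC := (real_complex R).
Local Notation t := (nu + 1).
Local Notation ph := (pochhammer t).

Let t0 : 0 < t. Proof. by rewrite -ltrBlDr sub0r. Qed.

Lemma pochhammerD (a : R) m n :
  pochhammer a (m + n) = pochhammer a m * pochhammer (a + m%:R) n.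
Proof.
rewrite /pochhammer big_split_ord /=; congr (_ * _).
by apply: eq_bigr => i _; rewrite natrD addrA.
Qed.

(** Both sides are (t)_(M+n) / ((t)_M (t)_n). *)
Lemma prod1D_pochhammer (M n : nat) :
  \prod_(j < M) (1 + n%:R / (t + j%:R)) = pochhammer (t + M%:R) n / ph n.
Proof.
have p0 k := lt0r_neq0 (pochhammer_gt0 t0 k).
have : \prod_(j < M) (1 + n%:R / (t + j%:R)) * ph M = pochhammer (t + n%:R) M.
  rewrite /pochhammer -big_split /=; apply: eq_bigr => j _.
  by rewrite mulrDl mul1r divfK ?tD_neq0// addrAC.
move=> E; apply: (mulIf (p0 M)); rewrite E; apply: (mulIf (p0 n)).
by rewrite mulrC -pochhammerD mulrAC divfK ?p0// mulrC -pochhammerD addnC.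
Qed.

Lemma ffact_prodr (m n : nat) : (m ^_ n)%:R = \prod_(i < n) (m%:R - i%:R) :> R.
Proof.
elim: n => [|n IH]; first by rewrite big_ord0.
rewrite big_ord_recr /= -IH ffactnSr natrM; have [nm|mn] := leqP n m.
  by rewrite natrB.
by rewrite ffact_small// !mul0r.
Qed.

(** The ratios of the coefficients of the approximants to those of w'. *)
Definition scale_factor (M n : nat) : R :=
  \prod_(i < n) (1 - i%:R / M.+1%:R) * \prod_(i < n) (1 + (t + i%:R) / M.+1%:R)
  * \prod_(i < n.*2) (1 + (t + i%:R) / M.+1%:R).

Definition multipliers (M : nat) : seq R :=
  1 :: [seq (t + j%:R)^-1 | j <- index_iota 0 M.+1]
    ++ [seq 2 / (t + j%:R) | j <- index_iota 0 M.+1].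

Definition approx (M : nat) : {poly R} :=
  \poly_(n < M.+2) ('C(M.+1, n)%:R * (- (16 * M.+1%:R ^+ 4)^-1) ^+ n
    * \prod_(d <- multipliers M) (1 + d * n%:R)).

Lemma poszeros_approx M : poszeros (approx M).
Proof.
apply: poszeros_coef; first by rewrite invr_gt0 mulr_gt0// exprn_gt0.
move=> d; rewrite inE => /orP[/eqP ->//|]; rewrite mem_cat => /orP[] /mapP[j _ ->].
  by rewrite invr_ge0 addr_ge0// ltW.
by rewrite divr_ge0// addr_ge0// ltW.
Qed.

Lemma prod_scale (M n : nat) (a : nat -> R) :
  \prod_(i < n) (a i) / M.+1%:R ^+ n = \prod_(i < n) (a i / M.+1%:R).
Proof. by rewrite big_split /= prodr_const card_ord exprVn. Qed.

Lemma coef_approx M n : (approx M)`_n = gcoef nu n * scale_factor M n.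
Proof.
have M0 : (M.+1%:R : R) != 0 by rewrite pnatr_eq0.
have wE : scale_factor M n = (M.+1 ^_ n)%:R / M.+1%:R ^+ n *
    (pochhammer (t + M.+1%:R) n / M.+1%:R ^+ n) *
    (pochhammer (t + M.+1%:R) n.*2 / M.+1%:R ^+ n.*2).
  rewrite ffact_prodr (prod_scale _ _ (fun i => M.+1%:R - i%:R)).
  rewrite !(prod_scale _ _ (fun i => t + M.+1%:R + i%:R)); congr (_ * _ * _);
    by apply: eq_bigr => i _; move: M0; move: (M.+1%:R) => m m0; field.
rewrite coef_poly; case: ltnP => [nM|Mn]; last first.
  by rewrite wE ffact_small// !mul0r mulr0.
have -> : \prod_(d <- multipliers M) (1 + d * n%:R) =
    n.+1%:R * (pochhammer (t + M.+1%:R) n / ph n)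
    * (pochhammer (t + M.+1%:R) n.*2 / ph n.*2).
  rewrite big_cons mul1r [1 + _]addrC natr1 big_cat !big_map !big_mkord.
  rewrite -!prod1D_pochhammer mulrA.
  congr (_ * _ * _); apply: eq_bigr => j _; first by rewrite mulrC.
  by rewrite -muln2 natrM; ring.
rewrite wE /gcoef /bcoef -(bin_ffact _ n) natrM -addnn exprD.
have : (n`!%:R : R) != 0 by rewrite pnatr_eq0 -lt0n fact_gt0.
have : ph n != 0 by exact/lt0r_neq0/pochhammer_gt0.
have : ph (n + n) != 0 by exact/lt0r_neq0/pochhammer_gt0.
have : (M.+1%:R ^+ n : R) != 0 by rewrite expf_neq0.
have -> : (- (16 * M.+1%:R ^+ 4)^-1) ^+ n = (-1) ^+ n / 16 ^+ n / (M.+1%:R ^+ n) ^+ 4 :> R.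
  by rewrite [LHS]exprNn exprVn exprMn invfM mulrA -exprM mulnC exprM.
have : (16 ^+ n : R) != 0 by rewrite expf_neq0// pnatr_eq0.
move: (M.+1%:R ^+ n) (ph n) (ph (n + n)) (n`!%:R) (16 ^+ n) ('C(_, _)%:R) ((-1) ^+ n)
  (pochhammer (t + _) n) (pochhammer (t + _) (n + n)) (n.+1%:R)
  => m p q f s c e u v k s0 m0 q0 p0 f0.
by field; rewrite s0 m0 q0 p0 f0.
Qed.

Lemma scale_factor_cvg n : scale_factor M n @[M --> \oo] --> (1 : R).
Proof.
have h (c : R) : 1 + c / M.+1%:R @[M --> \oo] --> (1 : R).
  rewrite -[X in _ --> X]addr0 -(mulr0 c); apply: cvgD; first exact: cvg_cst.
  by apply: cvgM; [exact: cvg_cst|exact: cvg_harmonic].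
have hp k (c : nat -> R) : \prod_(i < k) (1 + c i / M.+1%:R) @[M --> \oo] --> (1 : R).
  rewrite [X in _ --> X](_ : 1 = \prod_(i < k) 1); last by rewrite big1.
  by apply: cvg_big => [|i _]; [exact: mul_continuous|exact: h].
suff : scale_factor M n @[M --> \oo] --> (1 * 1 * 1 : R) by rewrite !mulr1.
apply: cvgM; last exact: (hp n.*2 (fun i => t + i%:R)).
apply: cvgM; last exact: (hp n (fun i => t + i%:R)).
by under eq_cvg do under eq_bigr do rewrite -mulNr; exact: (hp n (fun i => - i%:R)).
Qed.

Lemma mul_scale_factor_cvg (a : R) n : a * scale_factor M n @[M --> \oo] --> a.
Proof.
rewrite -[X in _ --> X]mulr1; apply: cvgM; [exact: cvg_cst|exact: scale_factor_cvg].
Qed.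

Lemma scale_factor_bound M n : (n <= M.+1)%N -> `|scale_factor M n| <= ((t + 3) ^+ 3) ^+ n.
Proof.
move=> nM; have M0 : (0 : R) < M.+1%:R by [].
have b k : (k <= M.+1.*2)%N ->
    0 <= \prod_(i < k) (1 + (t + i%:R) / M.+1%:R) <= (t + 3) ^+ k.
  move=> kM; rewrite prodr_ge0 => [|i _]; last by rewrite addr_ge0// divr_ge0// addr_ge0// ltW.
  rewrite -[leRHS](_ : \prod_(i < k) (t + 3) = _); last by rewrite prodr_const card_ord.
  apply: ler_prod => i _; have ti : 0 <= t + i%:R by exact: addr_ge0 (ltW t0) (ler0n _ _).
  rewrite (_ : t + 3 = 1 + (t + 2)); last by ring.
  rewrite lerD2l addr_ge0 ?(divr_ge0 ti)//=.
  rewrite ler_pdivrMr// mulrDl lerD//.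
    by rewrite ler_peMr ?(ltW t0)// ler1n.
  by rewrite -natrM ler_nat mul2n; apply/ltnW/(leq_trans (ltn_ord i)).
have /andP[b1 b1'] : 0 <= \prod_(i < n) (1 + (t + i%:R) / M.+1%:R) <= (t + 3) ^+ n.
  by apply: b; rewrite (leq_trans nM)// -addnn leq_addl.
have /b/andP[b2 b2'] : (n.*2 <= M.+1.*2)%N by rewrite leq_double.
have /andP[b3 b3'] : 0 <= \prod_(i < n) (1 - i%:R / M.+1%:R :> R) <= 1.
  have f (i : 'I_n) : 0 <= (1 - i%:R / M.+1%:R : R) <= 1.
    rewrite subr_ge0 gerBl divr_ge0// andbT ler_pdivrMr// mul1r ler_nat.
    exact: leq_trans (ltnW (ltn_ord i)) nM.
  rewrite prodr_ge0 => [|i _]; last by have /andP[] := f i.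
  by apply: prodr_ile1 => i _; exact: f.
rewrite /scale_factor ger0_norm ?mulr_ge0//.
have -> : ((t + 3) ^+ 3) ^+ n = 1 * (t + 3) ^+ n * (t + 3) ^+ n.*2.
  by rewrite mul1r -exprD -exprM -addnn mulSn mulSn mul1n addnA.
by rewrite ler_pM ?mulr_ge0// ler_pM.
Qed.

Let B := 2 * ((1 + t^-1) * (1 + t^-1)).
Let B0 : 0 <= B. Proof. by rewrite !mulr_ge0// addr_ge0// invr_ge0 ltW. Qed.

Lemma exp_bounded_approx M : exp_bounded B (2 * (t + 3) ^+ 3) (fun n => (approx M)`_n).
Proof.
move=> n; have t3 : 0 <= t + 3 by rewrite addr_ge0// ltW.
have [nM|Mn] := leqP n M.+1; last first.
  rewrite coef_poly ltnNge Mn /= normr0 divr_ge0// mulr_ge0// exprn_ge0//.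
  by rewrite mulr_ge0// exprn_ge0.
rewrite coef_approx normrM exprMn mulrA mulrAC.
by apply: ler_pM => //; [exact: (exp_bounded_gcoef hnu)|exact: scale_factor_bound].
Qed.

Lemma nC_cvg_norm (u : nat -> C) (l : C) :
  nC (u n - l) @[n --> \oo] --> (0 : R) -> nC (u n) @[n --> \oo] --> nC l.
Proof.
move=> ul; apply/cvgrPdist_lt => e e0.
have [N _ HN] := cvgr_lt _ ul e e0; exists N => // n /= /HN /= h.
apply: le_lt_trans h; rewrite ler_norml; apply/andP; split.
  by have := le_normcD (u n - l) l; rewrite subrK; lra.
by have := le_normcD (l - u n) (u n); rewrite subrK nC_distC; lra.
Qed.

Lemma approx_cvg (z : C) :
  (nC (map_poly toC (approx M)).[z] @[M --> \oo] --> nC (pser (gcoef nu) z)) /\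
  (nC (z * (map_poly toC (approx M)^`()).[z]) @[M --> \oo]
     --> nC (z * pser (pseries_diffs (gcoef nu)) z)).
Proof.
have K0 : 0 <= 2 * (t + 3) ^+ 3 by rewrite mulr_ge0// exprn_ge0// addr_ge0// ltW.
have cc n : (approx M)`_n @[M --> \oo] --> gcoef nu n.
  under eq_cvg do rewrite coef_approx.
  exact: mul_scale_factor_cvg.
split.
  apply: nC_cvg_norm; have := pser_dominated z exp_bounded_approx B0 K0 cc.
  by under eq_cvg do rewrite pser_poly.
have H : nC (pser (pseries_diffs (fun n => (approx M)`_n)) z -
             pser (pseries_diffs (gcoef nu)) z)
    @[M --> \oo] --> (0 : R).
  apply: (pser_dominated z (fun M => exp_bounded_diffs (exp_bounded_approx M))
    (mulr_ge0 B0 K0) K0) => n.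
  by apply: cvgM; [exact: cvg_cst|exact: cc].
apply: nC_cvg_norm.
have dE M : pser (pseries_diffs (fun n => (approx M)`_n)) z =
    (map_poly toC (approx M)^`()).[z].
  rewrite -pser_poly; congr (pser _ _); apply/funext => n.
  by rewrite coef_deriv /pseries_diffs mulr_natl.
have Hz : nC z * nC ((map_poly toC (approx M)^`()).[z] - pser (pseries_diffs (gcoef nu)) z)
   @[M --> \oo] --> nC z * 0.
  by apply: cvgM; [exact: cvg_cst|under eq_cvg do rewrite -dE; exact: H].
by rewrite mulr0 in Hz; under eq_cvg do rewrite -mulrBr Normc.normcM.
Qed.

(** The sum of the cubes of the inverse zeros, by [powersum3]. *)
Let cubic (c : nat -> R) := - c 1%N ^+ 3 + 3 * c 1%N * c 2%N - 3 * c 3%N.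

Lemma approx_cubic : cubic (fun n => (approx M + 'X * (approx M)^`())`_n) @[M --> \oo] -->
  cubic (dcoef nu).
Proof.
have cc n : (approx M + 'X * (approx M)^`())`_n.+1 @[M --> \oo] --> dcoef nu n.+1.
  have cE M : (approx M + 'X * (approx M)^`())`_n.+1 = dcoef nu n.+1 * scale_factor M n.+1.
    rewrite coefD coefXM coef_deriv /= coef_approx /dcoef -mulr_natl.
    by rewrite -[n.+2%:R]natr1; ring.
  under eq_cvg do rewrite cE.
  exact: mul_scale_factor_cvg.
rewrite /cubic; apply: cvgB; first apply: cvgD.
- apply: cvgN; under eq_cvg do rewrite exprS expr2.
  by rewrite exprS expr2; do 2!apply: cvgM => //.
- by apply: cvgM => //; apply: cvgM => //; exact: cvg_cst.
- by apply: cvgM => //; exact: cvg_cst.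
Qed.

(** There is room for some x > L with the same property. It also holds for the
    approximants of large degree, which then satisfy [poszeros_bound] on the disc
    of radius (L + x)/2 with th < 1 independent of the degree. *)
Lemma radius_gt (L : R) : 0 < L -> cubic (dcoef nu) * L ^+ 3 < 1 ->
  (L%:E < radius_of_convexity (bessel_w nu))%E.
Proof.
move=> L0 HL.
have [x Lx Hx] : exists2 x, L < x & cubic (dcoef nu) * x ^+ 3 < 1.
  have c : cubic (dcoef nu) * x ^+ 3 @[x --> L^'+] --> cubic (dcoef nu) * L ^+ 3.
    apply: cvgM; first exact: cvg_cst.
    by apply: cvg_at_right_filter; exact: exprn_continuous.
  near L^'+ => x; exists x; first by near: x; exact: nbhs_right_gt.
  by near: x; exact: cvgr_lt c _ HL.
have x0 : 0 < x by exact: lt_trans Lx.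
pose r := (L + x) / 2; pose th := r / x.
have [Lr rx] : L < r /\ r < x by rewrite /r; split; lra.
have r0 : 0 < r by exact: lt_trans Lr.
have th0 : 0 <= th by rewrite divr_ge0 ?ltW.
have th1 : th < 1 by rewrite ltr_pdivrMr// mul1r.
have thx : th * x = r by rewrite /th divfK// gt_eqF.
have [N _ HN] : \forall M \near \oo,
    cubic (fun n => (approx M + 'X * (approx M)^`())`_n) * x ^+ 3 < 1.
  have c : cubic (fun n => (approx M + 'X * (approx M)^`())`_n) * x ^+ 3 @[M --> \oo]
     --> cubic (dcoef nu) * x ^+ 3 by apply: cvgM; [exact: approx_cubic|exact: cvg_cst].
  exact: cvgr_lt c _ Hx.
have bd (z : C) M : nC z <= r -> (N <= M)%N ->
    nC (z * (map_poly toC (approx M)^`()).[z]) <= th * nC (map_poly toC (approx M)).[z] /\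
    1 - th <= nC (map_poly toC (approx M)).[z].
  move=> zr NM; have Hp := poszeros_approx M.
  have := poszeros_op Hp ler01; rewrite scale1r => -[s' s'0 qE].
  apply: (poszeros_bound Hp qE x0); rewrite ?thx ?th0 ?(ltW th1)//.
  by apply: poszeros_first_root => //; rewrite -qE; exact: HN.
have lim (z : C) : nC z <= r ->
    nC (z * pser (pseries_diffs (gcoef nu)) z) <= th * nC (pser (gcoef nu) z) /\
    1 - th <= nC (pser (gcoef nu) z).
  move=> zr; have [c1 c2] := approx_cvg z; split.
    rewrite -subr_ge0.
    have c : th * nC (map_poly toC (approx M)).[z] - nC (z * (map_poly toC (approx M)^`()).[z])
        @[M --> \oo] -->
        th * nC (pser (gcoef nu) z) - nC (z * pser (pseries_diffs (gcoef nu)) z).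
      by apply: cvgB => //; apply: cvgM => //; exact: cvg_cst.
    apply: (cvgr_to_ge c); exists N => // M /= NM; rewrite subr_ge0.
    by have [] := bd z M zr NM.
  apply: (cvgr_to_ge c1); exists N => // M /= NM.
  by have [] := bd z M zr NM.
apply: lt_le_trans (_ : (r%:E <= _)%E); first by rewrite lte_fin.
apply: ereal_sup_ubound; exists r => //; split => // z.
rewrite normC_nC ltcR => /ltW /lim.
rewrite Cderive_bessel_w// (Cderive_pser z (exp_bounded_gcoef hnu))//.
set W := pser (gcoef nu) z; set V := z * _ => -[h1 h2].
have W0 : W != 0.
  by apply/eqP => E; move: h2; rewrite E Normc.normc0 leNgt subr_gt0 th1.
split => //.
have nW := nC_gt0 W0.
have h : nC (V / W) <= th by rewrite Normc.normcM Normc.normcV ler_pdivrMr.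
have -> : complex.Re (1 + V / W) = 1 + complex.Re (V / W) by case: (V / W).
have := nC_Re (V / W); rewrite ler_norml => /andP[+ _]; lra.
Unshelve. all: by end_near. Qed.

End Lower.

(** * Upper bounds of the radius *)

Section Upper.
Variables (R : realType) (nu : R).
Hypothesis hnu : -1 < nu.
Local Notation C := R[i].
Local Notation nC := (@Normc.normc R).
Local Notation t := (nu + 1).
Local Notation ph := (pochhammer t).

Let t0 : 0 < t. Proof. by rewrite -ltrBlDr sub0r. Qed.

Definition altsum (u : nat -> R) N := \sum_(n < N) (-1) ^+ n * u n.

Lemma altsum_step (u : nat -> R) N k : (forall n, (N <= n)%N -> u n.+1 <= u n) ->
  (-1) ^+ N * altsum u N <= (-1) ^+ N * altsum u (N + k.*2).
Proof.
move=> uN; elim: k => [|k IH]; first by rewrite addn0.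
apply: le_trans IH _; rewrite doubleS !addnS /altsum !big_ord_recr /=.
set S := \sum_(i < _) _; set n := (N + k.*2)%N; have := uN n (leq_addr _ _).
have -> : (-1) ^+ n = (-1) ^+ N :> R.
  by rewrite /n -signr_odd oddD odd_double addbF signr_odd.
rewrite exprS => un; have s2 : (-1) ^+ N * (-1) ^+ N = 1 :> R by rewrite -expr2 sqrr_sign.
have -> : (-1) ^+ n = (-1) ^+ N :> R.
  by rewrite /n -signr_odd oddD odd_double addbF signr_odd.
have -> : (-1) ^+ N * (S + (-1) ^+ N * u n + -1 * (-1) ^+ N * u n.+1) =
   (-1) ^+ N * S + (-1) ^+ N * (-1) ^+ N * (u n - u n.+1) by ring.
by rewrite s2 mul1r lerDl subr_ge0.
Qed.

Lemma psum_real c (x : R) u N : (forall n, c n * x ^+ n = (-1) ^+ n * u n) ->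
  psum c x%:C N = (altsum u N)%:C.
Proof.
move=> cu; rewrite /psum big_mkord /altsum rmorph_sum; apply: eq_bigr => n _ /=.
by rewrite -rmorphXn -rmorphM cu.
Qed.

Lemma pser_real A K c (x : R) : exp_bounded A K c -> 0 <= A -> 0 <= K ->
  complex.Im (pser c x%:C) = 0.
Proof.
move=> cb A0 K0; apply/eqP; rewrite -normr_eq0 eq_le normr_ge0 andbT.
apply: (@le_of_cvg0 _ _ _ (fun n => A * etail (K * nC x%:C) n) 0); last exact: Aetail_cvg.
move=> n _; rewrite addr0; apply: le_trans (pser_tail x%:C n cb A0 K0).
apply: le_trans (nC_Im _); rewrite le_eqVlt; apply/orP; left; apply/eqP; congr (Num.norm _).
have -> : psum c x%:C n = (\sum_(0 <= k < n) c k * x ^+ k)%:C.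
  by rewrite /psum rmorph_sum; apply: eq_bigr => k _; rewrite rmorphM rmorphXn.
by case: (pser _ _) => u v /=; rewrite oppr0 addr0.
Qed.

(** Leibniz' criterion. The sign makes the partial sum an upper bound for odd N
    and a lower bound for even N. *)
Lemma pser_alternating A K c (x : R) u N : exp_bounded A K c -> 0 <= A -> 0 <= K -> 0 <= x ->
  (forall n, c n * x ^+ n = (-1) ^+ n * u n) -> (forall n, (N <= n)%N -> u n.+1 <= u n) ->
  (-1) ^+ N * altsum u N <= (-1) ^+ N * complex.Re (pser c x%:C).
Proof.
move=> cb A0 K0 x0 cu uN.
apply: (@le_of_cvg0 _ _ _ (fun n => A * etail (K * nC x%:C) n) 0); last exact: Aetail_cvg.
move=> n _; apply: le_trans (altsum_step n uN) _; set M := (N + n.*2)%N.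
have h := pser_tail x%:C M cb A0 K0.
have h2 : etail (K * nC x%:C) M <= etail (K * nC x%:C) n.
  apply: etail_anti; first by rewrite mulr_ge0 ?nC_ge0.
  by rewrite /M -addnn addnA (leq_trans _ (leq_addl _ _)).
have h3 := le_trans h (ler_wpM2l A0 h2).
have h4 := le_trans (nC_Re _) h3.
rewrite (psum_real _ cu) in h4.
have h5 : `|(-1) ^+ N * (complex.Re (pser c x%:C) - altsum u M)| <= A * etail (K * nC x%:C) n.
  rewrite normrM normrX normrN1 expr1n mul1r; apply: le_trans h4; rewrite le_eqVlt.
  by apply/orP; left; apply/eqP; congr (Num.norm _); case: (pser _ _).
rewrite mulrBr ler_norml in h5; have /andP[h6 h7] := h5.
by move: h6; rewrite lerBrDr addrC lerBlDl.
Qed.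

Definition bcoef_abs n : R := (n`!%:R * ph n * ph n.*2)^-1 / 16 ^+ n.

Lemma bcoefE n : bcoef nu n = (-1) ^+ n * bcoef_abs n.
Proof. by rewrite /bcoef /bcoef_abs mulrA. Qed.

Lemma bcoef_abs_gt0 n : 0 < bcoef_abs n.
Proof.
by rewrite divr_gt0 ?exprn_gt0// invr_gt0 !mulr_gt0 ?pochhammer_gt0// ltr0n fact_gt0.
Qed.

(** In the variable y = z/zscale the zeros of D stay bounded away from 0, and the
    first one from infinity: it tends to 1/4 for t -> 0 and to (3 - sqrt 5)/2
    for t -> +oo. *)
Definition zscale : R := 16 * t ^+ 2 * (t + 1).

Lemma zscale_gt0 : 0 < zscale.
Proof. by rewrite !mulr_gt0 ?exprn_gt0// addr_gt0. Qed.

Lemma bcoef_abs_step n y : 0 <= y ->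
  bcoef_abs n.+1 * (zscale * y) <= bcoef_abs n * (y / n.+1%:R).
Proof.
move=> y0; set p := (t + n%:R) * (t + n.*2%:R) * (t + n.*2.+1%:R).
have tn k : 0 < t + k%:R by rewrite ltr_wpDr.
have p0 : 0 < p by rewrite !mulr_gt0.
have -> : bcoef_abs n.+1 = bcoef_abs n / (16 * n.+1%:R * p).
  rewrite /bcoef_abs doubleS !pochhammerS factS natrM exprS /p.
  have := lt0r_neq0 (pochhammer_gt0 t0 n); have := lt0r_neq0 (pochhammer_gt0 t0 n.*2).
  have := lt0r_neq0 (tn n); have := lt0r_neq0 (tn n.*2); have := lt0r_neq0 (tn n.*2.+1).
  have : (n`!%:R : R) != 0 by rewrite pnatr_eq0 -lt0n fact_gt0.
  have : (n.+1%:R : R) != 0 by rewrite pnatr_eq0.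
  have : (16 ^+ n : R) != 0 by rewrite expf_neq0// pnatr_eq0.
  move: (t + n.*2.+1%:R) (t + n.*2%:R) (t + n%:R) (ph n.*2) (ph n) (n`!%:R) (n.+1%:R)
    (16 ^+ n).
  move=> a b c d e f g h h0 g0 f0 a0 b0 c0 d0 e0.
  by field; rewrite h0 g0 f0 a0 b0 c0 d0 e0.
have n0 : (n.+1%:R : R) != 0 by rewrite pnatr_eq0.
have -> : bcoef_abs n / (16 * n.+1%:R * p) * (zscale * y) =
  bcoef_abs n * (y / n.+1%:R) * ((t * t * (t + 1)) / p).
  rewrite /zscale; move: p p0 (bcoef_abs n) (n.+1%:R) n0 => q /lt0r_neq0 q0 b m m0.
  by field; rewrite q0 m0.
rewrite ler_piMr//; first by apply: mulr_ge0; [exact/ltW/bcoef_abs_gt0|exact: divr_ge0].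
rewrite ler_pdivrMr// mul1r /p.
have tk k : t <= t + k%:R by rewrite lerDl.
have t0' := ltW t0.
apply: ler_pM; [exact: mulr_ge0|exact: addr_ge0|exact: ler_pM|].
by rewrite lerD2l ler1n.
Qed.

Let sqr_ratio_le n y : 0 <= y -> y <= 1 / 2 -> (1 <= n)%N ->
  (n.+2%:R ^+ 2) * (y / n.+1%:R) <= n.+1%:R ^+ 2 :> R.
Proof.
move=> y0 y1 n1; have n1' : 1 <= n%:R :> R by rewrite ler1n.
rewrite mulrA ler_pdivrMr// -[n.+2]addn2 -[n.+1]addn1 !natrD.
move: (n%:R : R) n1' => a a1; have : (a + 2) ^+ 2 * y <= (a + 2) ^+ 2 * (1 / 2).
  by rewrite ler_wpM2l// sqr_ge0.
by nra.
Qed.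

Lemma gterm_step n y : 0 <= y -> y <= 1 / 2 ->
  n.+2%:R * (bcoef_abs n.+1 * (zscale * y) ^+ n.+1) <=
  n.+1%:R * (bcoef_abs n * (zscale * y) ^+ n).
Proof.
move=> y0 y1; have s0 : 0 <= zscale * y by rewrite mulr_ge0// ltW// zscale_gt0.
rewrite [(zscale * y) ^+ n.+1]exprS [bcoef_abs n.+1 * _]mulrA.
rewrite [leLHS]mulrA [leRHS]mulrA ler_wpM2r ?exprn_ge0//.
apply: le_trans (ler_wpM2l _ (bcoef_abs_step n y0)) _ => //.
rewrite mulrCA mulrC ler_wpM2r ?(ltW (bcoef_abs_gt0 n))// mulrA ler_pdivrMr//.
rewrite -[n.+2]addn2 -[n.+1]addn1 !natrD; have : (0 : R) <= n%:R by [].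
by move: (n%:R : R) => a a0; nra.
Qed.

Lemma dterm_step n y : 0 <= y -> y <= 1 / 2 -> (1 <= n)%N ->
  n.+2%:R ^+ 2 * (bcoef_abs n.+1 * (zscale * y) ^+ n.+1) <=
  n.+1%:R ^+ 2 * (bcoef_abs n * (zscale * y) ^+ n).
Proof.
move=> y0 y1 n1; have s0 : 0 <= zscale * y by rewrite mulr_ge0// ltW// zscale_gt0.
rewrite [(zscale * y) ^+ n.+1]exprS [bcoef_abs n.+1 * _]mulrA.
rewrite [leLHS]mulrA [leRHS]mulrA ler_wpM2r ?exprn_ge0//.
apply: le_trans (ler_wpM2l _ (bcoef_abs_step n y0)) _; first exact: sqr_ge0.
by rewrite mulrCA mulrC ler_wpM2r ?(ltW (bcoef_abs_gt0 n))// sqr_ratio_le.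
Qed.

(** The first five terms of D at zscale * y. Four would be negative at [yU] as
    well but they do not bound D from above. *)
Definition dtrunc y : R := 1 - 4 * y + 9 * (t ^+ 2 / (2 * (t + 2) * (t + 3))) * y ^+ 2
  - 16 * (t ^+ 4 * (t + 1) / (6 * (t + 2) ^+ 2 * (t + 3) * (t + 4) * (t + 5))) * y ^+ 3
  + 25 * (t ^+ 6 * (t + 1) ^+ 2
      / (24 * (t + 2) ^+ 2 * (t + 3) ^+ 2 * (t + 4) * (t + 5) * (t + 6) * (t + 7))) * y ^+ 4.

Lemma bcoef_abs_zscale :
  [/\ bcoef_abs 0 = 1, bcoef_abs 1 * zscale = 1,
    bcoef_abs 2 * zscale ^+ 2 = t ^+ 2 / (2 * (t + 2) * (t + 3)),
    bcoef_abs 3 * zscale ^+ 3 =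
      t ^+ 4 * (t + 1) / (6 * (t + 2) ^+ 2 * (t + 3) * (t + 4) * (t + 5))
  & bcoef_abs 4 * zscale ^+ 4 = t ^+ 6 * (t + 1) ^+ 2
      / (24 * (t + 2) ^+ 2 * (t + 3) ^+ 2 * (t + 4) * (t + 5) * (t + 6) * (t + 7))].
Proof.
have n0 := lt0r_neq0 t0; have nk k := tD_neq0 t0 k.
move: (nk 1%N) (nk 2%N) (nk 3%N) (nk 4%N) (nk 5%N) (nk 6%N) (nk 7%N) => n1 n2 n3 n4 n5 n6 n7.
rewrite /bcoef_abs /zscale; move: n0 n1 n2 n3 n4 n5 n6 n7; clear.
move: t => s n0 n1 n2 n3 n4 n5 n6 n7.
rewrite /= !pochhammerS !pochhammer0 !mulr1n addr0 mul1r.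
split.
- by field.
- by field; rewrite n0 n1.
- by rewrite !factS fact0 !natrM; field; rewrite n0 n1 n2 n3.
- by rewrite !factS fact0 !natrM; field; rewrite n0 n1 n2 n3 n4 n5.
- by rewrite !factS fact0 !natrM; field; rewrite n0 n1 n2 n3 n4 n5 n6 n7.
Qed.

Let B := 2 * ((1 + t^-1) * (1 + t^-1)).
Let B0 : 0 <= B. Proof. by rewrite !mulr_ge0// addr_ge0// invr_ge0 ltW. Qed.

Lemma dcoefE n : dcoef nu n = (-1) ^+ n * (n.+1%:R ^+ 2 * bcoef_abs n).
Proof.
rewrite /dcoef /gcoef bcoefE.
by move: ((-1) ^+ n) (n.+1%:R : R) (bcoef_abs n) => s k b; ring.
Qed.

Lemma exp_bounded_dcoef : exp_bounded B 4 (dcoef nu).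
Proof.
move=> n; rewrite /dcoef normrM ger0_norm//.
have nb : n.+1%:R <= 2 ^+ n :> R by rewrite -natrX ler_nat; exact: ltn_expl.
apply: le_trans (ler_pM _ _ nb (exp_bounded_gcoef hnu n)) _ => //.
rewrite (_ : (4 : R) = 2 * 2) ?exprMn; last by rewrite -natrM.
rewrite le_eqVlt; apply/orP; left; apply/eqP; rewrite /B.
by move: (2 ^+ n) (n`!%:R^-1) => u v; ring.
Qed.

Lemma pser_gcoef_ge y : 0 <= y -> y <= 1 / 2 ->
  1 - 2 * y <= complex.Re (pser (gcoef nu) (zscale * y)%:C).
Proof.
move=> y0 y1; pose u n := n.+1%:R * (bcoef_abs n * (zscale * y) ^+ n).
have s0 : 0 <= zscale * y by rewrite mulr_ge0// ltW// zscale_gt0.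
have cu n : gcoef nu n * (zscale * y) ^+ n = (-1) ^+ n * u n.
  by rewrite /gcoef bcoefE /u !mulrA [n.+1%:R * (-1) ^+ n]mulrC.
have := @pser_alternating _ _ _ _ u 2 (exp_bounded_gcoef hnu) B0 (ler0n _ 2) s0 cu
  (fun n _ => gterm_step n y0 y1).
rewrite (_ : (-1) ^+ 2 = 1 :> R) ?expr2 ?mulN1r ?opprK// !mul1r.
rewrite /altsum !big_ord_recr big_ord0 /= /u; apply: le_trans.
have [b0 b1 _ _ _] := bcoef_abs_zscale; rewrite le_eqVlt; apply/orP; left; apply/eqP.
rewrite b0 !expr0 !expr1 [bcoef_abs 1 * _]mulrA b1; ring.
Qed.

Lemma pser_dcoef_le y : 0 <= y -> y <= 1 / 2 ->
  complex.Re (pser (dcoef nu) (zscale * y)%:C) <= dtrunc y.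
Proof.
move=> y0 y1; pose u n := n.+1%:R ^+ 2 * (bcoef_abs n * (zscale * y) ^+ n).
have s0 : 0 <= zscale * y by rewrite mulr_ge0// ltW// zscale_gt0.
have cu n : dcoef nu n * (zscale * y) ^+ n = (-1) ^+ n * u n.
  by rewrite dcoefE /u !mulrA.
have := @pser_alternating _ _ _ _ u 5 exp_bounded_dcoef B0 (ler0n _ 4) s0 cu
  (fun n n5 => dterm_step y0 y1 (leq_trans (isT : (1 <= 5)%N) n5)).
have s5 : (-1) ^+ 5 = -1 :> R by rewrite -signr_odd expr1.
rewrite s5 !mulN1r lerN2 => /le_trans; apply.
have [b0 b1 b2 b3 b4] := bcoef_abs_zscale.
rewrite /altsum !big_ord_recr big_ord0 /= /u /dtrunc -b2 -b3 -b4 b0 !exprMn !expr0.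
have e1 : bcoef_abs 1 * (zscale ^+ 1 * y ^+ 1) = y by rewrite !expr1 mulrA b1 mul1r.
rewrite e1 le_eqVlt; apply/orP; left; apply/eqP.
by move: (bcoef_abs 2) (bcoef_abs 3) (bcoef_abs 4) zscale => p q r v; ring.
Qed.

(** At such a point w' > 0 by its first two terms, while D <= 0. *)
Lemma radius_le y : 0 < y -> y < 1 / 2 -> dtrunc y <= 0 ->
  (radius_of_convexity (bessel_w nu) <= (zscale * y)%:E)%E.
Proof.
move=> y0 y1 Ey; have s0 : 0 < zscale * y by rewrite mulr_gt0// zscale_gt0.
apply: ge_ereal_sup => _ [r [r0 H] <-]; rewrite lee_fin leNgt; apply/negP => sr.
have [|_] := H (zscale * y)%:C; first by rewrite normC_nC nC_real gtr0_norm// ltcR.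
set z := (zscale * y)%:C.
have := Cderive2_bessel_w hnu z; rewrite Cderive_bessel_w//.
set W := pser (gcoef nu) z; set V := z * _ => VW.
have W0 : 0 < complex.Re W.
  by apply: lt_le_trans (pser_gcoef_ge (ltW y0) (ltW y1)); lra.
have Wr : W = (complex.Re W)%:C.
  have := pser_real (zscale * y) (exp_bounded_gcoef hnu) B0 (ler0n _ 2); rewrite -/z -/W.
  by case: W {W0 VW} => u v /= ->.
have Wn : W != 0 by rewrite Wr fmorph_eq0 gt_eqF.
have -> : 1 + V / W = (V + W) / W by field.
have D0 := le_trans (pser_dcoef_le (ltW y0) (ltW y1)) Ey; rewrite -/z -VW in D0.
rewrite [X in _ / X]Wr -fmorphV; move: (V + W) (complex.Re W) W0 D0 => [a b] w w0 /= a0.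
by rewrite mulr0 subr0 ltNge mulr_le0_ge0// invr_ge0 ltW.
Qed.

Lemma nu19E : nu19 nu = polyA t.
Proof. by rewrite /nu19 /polyA; ring. Qed.

Lemma nu20E : nu20 nu = polyB t.
Proof. by rewrite /nu20 /polyB; ring. Qed.

(** The sharpest upper and lower bounds of the radius are zscale * yU and
    zscale * yL. *)
Definition yU : R := (t + 2) * (t + 4) * (t + 5) * polyA t / (2 * polyB t).

Lemma yU_bounds : 0 < yU < 1 / 2.
Proof.
have A0 := polyA_gt0 t0; have Bp := polyB_gt0 t0; have h := bound_first t0.
have B2 : 0 < 2 * polyB t by rewrite mulr_gt0.
have tk (k : R) : 0 < k -> 0 < t + k by move=> k0; rewrite addr_gt0.
rewrite /yU divr_gt0 ?mulr_gt0 ?tk//= ltr_pdivrMr// mul1r.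
by rewrite mulrA mulVf// mul1r.
Qed.

Lemma dtrunc_yU : dtrunc yU < 0.
Proof.
have := bound_quartic t0 (erefl _) (erefl _).
have := polyA_gt0 t0; have := polyB_gt0 t0; rewrite /dtrunc /yU.
move: (polyA t) (polyB t) => a b; move: t t0 => s s0 b0 a0 h.
pose D := 384 * (s + 3) ^+ 2 * (s + 6) * (s + 7) * b ^+ 4.
have sk (k : R) : 0 < k -> 0 < s + k by move=> k0; rewrite addr_gt0.
have sk' (k : R) : 0 < k -> s + k != 0 by move=> k0; exact/lt0r_neq0/sk.
have D0 : 0 < D by rewrite /D !mulr_gt0 ?exprn_gt0 ?sk.
rewrite -(pmulr_llt0 _ D0) /D -subr_gt0; rewrite -subr_gt0 in h.
apply: etrans h; congr (0 < _); field.
by rewrite !sk' ?(gt_eqF b0).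
Qed.

Lemma radius_lt_U : (radius_of_convexity (bessel_w nu) < (zscale * yU)%:E)%E.
Proof.
have /andP[U0 U1] := yU_bounds.
have [y [y0 yU' Ey]] : exists y, [/\ 0 < y, y < yU & dtrunc y <= 0].
  have c : dtrunc y @[y --> yU^'-] --> dtrunc yU.
    apply: cvg_at_left_filter; rewrite /dtrunc.
    have M (a : R) k : a * y ^+ k @[y --> yU] --> a * yU ^+ k.
      by apply: cvgM; [exact: cvg_cst|exact: exprn_continuous].
    apply: cvgD; last exact: M; apply: cvgB; last exact: M; apply: cvgD; last exact: M.
    by apply: cvgB; [exact: cvg_cst|exact: (M 4 1%N)].
  near yU^'- => y; exists y; split.
  - by near: y; exact: nbhs_left_gt.
  - by near: y; exact: nbhs_left_lt.
  - by apply: ltW; near: y; exact: cvgr_lt c _ dtrunc_yU.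
apply: le_lt_trans (radius_le y0 (lt_trans yU' U1) Ey) _.
by rewrite lte_fin ltr_pM2l// zscale_gt0.
Unshelve. all: by end_near. Qed.

Lemma cubic_dcoef : (- dcoef nu 1 ^+ 3 + 3 * dcoef nu 1 * dcoef nu 2 - 3 * dcoef nu 3)
   * zscale ^+ 3 = 2 * polyB t / ((t + 2) ^+ 2 * (t + 3) * (t + 4) * (t + 5)).
Proof.
have [_ b1 b2 b3 _] := bcoef_abs_zscale.
have -> : (- dcoef nu 1 ^+ 3 + 3 * dcoef nu 1 * dcoef nu 2 - 3 * dcoef nu 3) * zscale ^+ 3 =
  64 * (bcoef_abs 1 * zscale) ^+ 3 - 108 * (bcoef_abs 1 * zscale) * (bcoef_abs 2 * zscale ^+ 2)
  + 48 * (bcoef_abs 3 * zscale ^+ 3).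
  by rewrite !dcoefE; move: (bcoef_abs 1) (bcoef_abs 2) (bcoef_abs 3) zscale => p q r v; ring.
rewrite b1 b2 b3 /polyB.
have sk (k : R) : 0 < k -> t + k != 0 by move=> k0; exact/lt0r_neq0/addr_gt0.
by move: t sk => s sk; field; rewrite !sk.
Qed.

Definition yL : R := Num.sqrt ((t + 2) * (t + 3) / polyA t).

Lemma yL_gt : 1 / 4 < yL.
Proof.
have A0 := polyA_gt0 t0; have h := bound_lower t0.
rewrite -(@ltr_pXn2r _ 2) ?nnegrE ?sqrtr_ge0// sqr_sqrtr; last first.
  by apply/ltW/divr_gt0 => //; apply: mulr_gt0; exact: addr_gt0.
by rewrite ltr_pdivlMr//; lra.
Qed.

Lemma radius_gt_L : ((zscale * yL)%:E < radius_of_convexity (bessel_w nu))%E.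
Proof.
have A0 := polyA_gt0 t0; have B1 := polyB_gt0 t0; have h := bound_cubic t0.
have y0 : 0 < yL by apply: lt_trans yL_gt; lra.
apply: radius_gt => //; first by rewrite mulr_gt0// zscale_gt0.
rewrite [(_ * yL) ^+ 3]exprMn [ltLHS]mulrA cubic_dcoef.
have sk (k : R) : 0 < k -> 0 < t + k by move=> k0; rewrite addr_gt0.
set c := _ / _; have c0 : 0 < c.
  by rewrite /c divr_gt0 ?mulr_gt0 ?exprn_gt0 ?sk.
have cy : 0 <= c * yL ^+ 3 by exact: mulr_ge0 (ltW c0) (exprn_ge0 _ (ltW y0)).
rewrite -(@ltr_pXn2r _ 2) ?nnegrE// expr1n [(c * _) ^+ 2]exprMn.
rewrite -exprM mulnC exprM sqr_sqrtr; last first.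
  by apply/ltW/divr_gt0 => //; apply: mulr_gt0; exact: sk.
have -> : c ^+ 2 * ((t + 2) * (t + 3) / polyA t) ^+ 3 =
   4 * (t + 3) * polyB t ^+ 2 / ((t + 2) * (t + 4) ^+ 2 * (t + 5) ^+ 2 * polyA t ^+ 3).
  rewrite /c; have sk' (k : R) : 0 < k -> t + k != 0 by move=> k0; exact/lt0r_neq0/sk.
  have A1 : polyA t != 0 by rewrite gt_eqF.
  move: (polyA t) (polyB t) A1 sk' => a b a0; move: t => s sk'.
  by field; rewrite a0 !sk'.
by rewrite ltr_pdivrMr ?mul1r// !mulr_gt0 ?exprn_gt0 ?sk.
Qed.

End Upper.

(** * The theorem *)

Theorem theorem17 (R : realType) (nu : R) (hnu : -1 < nu) :
  (radius_of_convexity (bessel_w nu)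
     < (8 * (nu + 1) ^+ 2 * (nu + 2))%:E)%E
  /\
  ((4 * (nu + 1) ^+ 2 * (nu + 2))%:E
     < radius_of_convexity (bessel_w nu)
     < (64 * (nu + 1) * pochhammer (nu + 1) 4 / nu19 nu)%:E)%E
  /\
  ((16 * (nu + 1) ^+ 2 * (nu + 2)
      * Num.sqrt ((nu + 3) * (nu + 4) / nu19 nu))%:E
     < radius_of_convexity (bessel_w nu)
     < (8 * (nu + 1) * pochhammer (nu + 1) 3 * pochhammer (nu + 5) 2
          * nu19 nu / nu20 nu)%:E)%E.
Proof.
have t0 : 0 < nu + 1 by rewrite -ltrBlDr sub0r.
have A0 := polyA_gt0 t0; have B0 := polyB_gt0 t0; have s0 := zscale_gt0 hnu.
have upper := radius_lt_U hnu; have lower := radius_gt_L hnu.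
have /andP[_ U1] := yU_bounds hnu; have L1 := yL_gt hnu.
have zscaleE (y : R) : zscale nu * y = 16 * (nu + 1) ^+ 2 * (nu + 2) * y.
  by rewrite /zscale; ring.
have UE : zscale nu * yU nu = 8 * (nu + 1) * pochhammer (nu + 1) 3
    * pochhammer (nu + 5) 2 * nu19 nu / nu20 nu.
  rewrite /zscale /yU nu19E nu20E !pochhammerS !pochhammer0.
  have : polyB (nu + 1) != 0 by rewrite gt_eqF.
  by move: (polyA _) (polyB _) => a b b0; field.
have LE : zscale nu * yL nu =
    16 * (nu + 1) ^+ 2 * (nu + 2) * Num.sqrt ((nu + 3) * (nu + 4) / nu19 nu).
  rewrite zscaleE /yL nu19E; congr (_ * Num.sqrt (_ / _)); ring.
have E8 : 8 * (nu + 1) ^+ 2 * (nu + 2) = zscale nu * (1 / 2) by rewrite /zscale; field.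
have E4 : 4 * (nu + 1) ^+ 2 * (nu + 2) = zscale nu * (1 / 4) by rewrite /zscale; field.
split; first by apply: lt_trans upper _; rewrite lte_fin E8 ltr_pM2l.
split; apply/andP; split.
- by apply: lt_trans lower; rewrite lte_fin E4 ltr_pM2l.
- apply: lt_trans upper _; rewrite lte_fin nu19E !pochhammerS pochhammer0.
  have h := bound_second t0; rewrite /yU /zscale.
  move: (polyA _) (polyB _) A0 B0 h => a b a0 b0.
  move: (nu + 1) t0 => t t0 h.
  pose k := 8 * t ^+ 2 * (t + 1) * (t + 2).
  have k0 : 0 < k by rewrite !mulr_gt0 ?exprn_gt0 ?addr_gt0.
  have -> : 16 * t ^+ 2 * (t + 1) * ((t + 2) * (t + 4) * (t + 5) * a / (2 * b)) =
      k / a * ((t + 4) * (t + 5) * a ^+ 2 / b).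
    by rewrite /k; field; rewrite !gt_eqF.
  rewrite [ltRHS](_ : _ = k / a * (8 * (t + 3))); last first.
    by rewrite /k; field; rewrite !gt_eqF.
  by rewrite ltr_pM2l ?divr_gt0// ltr_pdivrMr.
- by rewrite -LE.
- by rewrite -UE.
Qed.
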